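(* In the coordinator model, the randomized communication complexity of solving a linear system is $\tilde{\Theta}(d^2L + sd)$, while the deterministic communication complexity is $\tilde{\Theta}(sd^2L)$. In the blackboard model, both the randomized and the deterministic communication complexity of solving a linear system are $\tilde{\Theta}(d^2L + s)$.
   Context: Distributed setting: there are $s \ge 2$ servers $P_1,\dots,P_s$ and a coordinator. A matrix $A \in \mathbb{R}^{n\times d}$ and a vector $b \in \mathbb{R}^n$, all of whose entries are integers in $[-2^L, 2^L]$, are distributed row-wise: the rows of $[A~b]$ are partitioned among the servers, server $P_i$ holding the subsystem $A^{(i)}x = b^{(i)}$. In the coordinator model each server can only exchange messages with the coordinator over a private two-way channel; in the blackboard model every message is written on a shared blackboard visible to all parties, and the order of speaking is determined by the blackboard contents. The communication complexity is the total number of bits sent. Solving a linear system means that at termination the coordinator either outputs $x \in \mathbb{R}^d$ with $Ax=b$ or correctly reports that $Ax=b$ is infeasible; randomized protocols are required to succeed with constant probability (e.g. $0.99$) on every input. For a function $f$, $\tilde{O}(f) = f\cdot \mathrm{polylog}(sndL)$, and $\tilde{\Omega}, \tilde{\Theta}$ are defined analogously.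
   Formalization: The lower bounds are claimed only when n is large enough: n ≥ sd for the deterministic coordinator bound, n ≥ s+d−1 for the others. For small n they fail: a system with n = 1 and s = 2 can be sent in O(dL) bits. The upper bounds hold for all n. *)

(* Defs.v *)
From mathcomp Require Import all_boot all_order all_algebra.
From mathcomp Require Import all_classical all_reals all_analysis.

Set Implicit Arguments.
Unset Strict Implicit.
Unset Printing Implicit Defensive.

Import Order.TTheory GRing.Theory Num.Theory.
Local Open Scope ring_scope.

(* Protocols exchange single bits.  [X0] is the local data of the coordinator,
   [X] that of each server, [O] the type of the coordinator's outputs. *)

Section Protocols.
Variables (s : nat) (X0 X O : Type).

Inductive direction := to_server | to_coordinator.

Inductive coord_action :=
  | Tell of 'I_s & bool
  | Ask of 'I_s
  | Output of O.

(* Every message passes through the coordinator, so the coordinator sees the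
   whole history and schedules the next bit.  A server sees nothing but the
   bits exchanged on its own channel, in particular not when they are exchanged;
   so asking for a bit is free, and only the bit itself is charged. *)
Record coord_protocol := CoordProtocol {
  coord_next : X0 -> seq ('I_s * (direction * bool)) -> coord_action;
  coord_reply : 'I_s -> X -> seq (direction * bool) -> bool }.

Definition channel (i : 'I_s) (h : seq ('I_s * (direction * bool))) :
  seq (direction * bool) := [seq e.2 | e <- h & e.1 == i].

(* [Some o] if the protocol, started from history [h], outputs [o] after at
   most [c] further bits, and [None] otherwise. *)
Fixpoint coord_run_from (P : coord_protocol) (x0 : X0) (x : 'I_s -> X)
    (c : nat) (h : seq ('I_s * (direction * bool))) : option O :=
  match coord_next P x0 h, c with
  | Output o, _ => Some o
  | Tell i a, c'.+1 => coord_run_from P x0 x c' (rcons h (i, (to_server, a)))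
  | Ask i, c'.+1 =>
      let a := coord_reply P i (x i) (channel i h) in
      coord_run_from P x0 x c' (rcons h (i, (to_coordinator, a)))
  | _, 0%N => None
  end.

Inductive party := Coordinator | Server of 'I_s.

(* The next speaker (or the end of the protocol, [None]) depends only on the
   contents of the board. *)
Record board_protocol := BoardProtocol {
  board_turn : seq bool -> option party;
  board_coord : X0 -> seq bool -> bool;
  board_server : 'I_s -> X -> seq bool -> bool;
  board_output : X0 -> seq bool -> O }.

Fixpoint board_run_from (P : board_protocol) (x0 : X0) (x : 'I_s -> X)
    (c : nat) (h : seq bool) : option O :=
  match board_turn P h, c with
  | None, _ => Some (board_output P x0 h)
  | Some Coordinator, c'.+1 =>
      board_run_from P x0 x c' (rcons h (board_coord P x0 h))
  | Some (Server i), c'.+1 =>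
      board_run_from P x0 x c' (rcons h (board_server P i (x i) h))
  | _, 0%N => None
  end.

End Protocols.

Inductive model := coordinator_model | blackboard_model.

Definition protocol (m : model) (s : nat) (X0 X O : Type) : Type :=
  match m with
  | coordinator_model => coord_protocol s X0 X O
  | blackboard_model => board_protocol s X0 X O
  end.

Definition run (m : model) (s : nat) (X0 X O : Type) :
    protocol m s X0 X O -> X0 -> ('I_s -> X) -> nat -> option O :=
  match m with
  | coordinator_model => fun P x0 x c => coord_run_from P x0 x c [::]
  | blackboard_model => fun P x0 x c => board_run_from P x0 x c [::]
  end.

Record linsys (s n d : nat) := LinSys {
  lhs : 'M[int]_(n, d);
  rhs : 'cV[int]_n;
  holder : 'I_n -> 'I_s }.

Definition entries_bounded (s n d L : nat) (I : linsys s n d) : Prop :=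
  (forall i j, `|lhs I i j| <= 2 ^+ L) /\ (forall i, `|rhs I i 0| <= 2 ^+ L).

(* The rows of [A^(i) b^(i)]; a server may hold no row at all. *)
Definition held (s n d : nat) (I : linsys s n d) (i : 'I_s) :
  seq 'rV[int]_(d + 1) :=
  [seq row j (row_mx (lhs I) (rhs I)) | j <- enum 'I_n & holder I j == i].

Section Complexity.
Variable R : realType.

Definition solution (s n d : nat) (I : linsys s n d) (x : 'cV[R]_d) : Prop :=
  map_mx intr (lhs I) *m x = map_mx intr (rhs I).

(* The answer [None] reports infeasibility. *)
Definition correct (s n d : nat) (I : linsys s n d) (o : option 'cV[R]_d) :
  Prop :=
  match o with
  | Some x => solution I x
  | None => ~ exists x : 'cV[R]_d, solution I x
  end.

(* [r] is the result of a run, itself an [option]: [None] means that the run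
   has not terminated within its budget. *)
Definition succeeds (s n d : nat) (I : linsys s n d)
    (r : option (option 'cV[R]_d)) : Prop :=
  exists2 o, r = Some o & correct I o.

Definition proba (W : finType) (E : W -> Prop) : R :=
  #|[pred w : W | `[< E w >]]|%:R / #|W|%:R.

Definition deterministically_solvable (m : model) (s n d L c : nat) : Prop :=
  exists P : protocol m s unit (seq 'rV[int]_(d + 1)) (option 'cV[R]_d),
  forall I : linsys s n d, entries_bounded L I ->
    succeeds I (run P tt (held I) c).

Inductive coins := public_coins | private_coins.

(* Coins are drawn uniformly from a finite type.  Public coins select a
   deterministic protocol; private coins are independent, and each party
   (coordinator included) sees only its own.  The cost is the worst case over
   inputs and coins. *)
Definition randomly_solvable (k : coins) (m : model) (s n d L c : nat) :
    Prop :=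
  match k with
  | public_coins =>
      exists (W : finType)
        (P : W -> protocol m s unit (seq 'rV[int]_(d + 1)) (option 'cV[R]_d)),
      forall I : linsys s n d, entries_bounded L I ->
        let result w := run (P w) tt (held I) c in
        (forall w, result w <> None) /\
        99%:R / 100%:R <= proba (fun w => succeeds I (result w))
  | private_coins =>
      exists (W : finType)
        (P : protocol m s W (seq 'rV[int]_(d + 1) * W) (option 'cV[R]_d)),
      forall I : linsys s n d, entries_bounded L I ->
        let result (w : W * {ffun 'I_s -> W}) :=
          run P w.1 (fun i => (held I i, w.2 i)) c in
        (forall w, result w <> None) /\
        99%:R / 100%:R <= proba (fun w => succeeds I (result w))
  end.

(* [+oo] if there is no such protocol. *)
Definition least_cost (solvable : nat -> Prop) : \bar R :=
  ereal_inf [set (c%:R)%:E | c in [set c | solvable c]]%classic.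

Definition deterministic_complexity (m : model) (s n d L : nat) : \bar R :=
  least_cost (deterministically_solvable m s n d L).

Definition randomized_complexity (k : coins) (m : model) (s n d L : nat) :
  \bar R := least_cost (randomly_solvable k m s n d L).

(* In the bounds below s >= 2 and n, d, L >= 1, so s n d L >= 2 and this
   logarithm is bounded away from 0. *)

Definition logpow (k s n d L : nat) : R := ln ((s * n * d * L)%N%:R) ^+ k.

Definition soft_O (T : nat -> nat -> nat -> nat -> \bar R)
    (f : nat -> nat -> nat -> nat) : Prop :=
  exists (C : R) (k : nat), forall s n d L : nat,
    (2 <= s)%N -> (0 < n)%N -> (0 < d)%N -> (0 < L)%N ->
    (T s n d L <= (C * (f s d L)%:R * logpow k s n d L)%:E)%E.

(* The bounds do not involve n, and n rows can be sent in O(n d L) bits, so a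
   lower bound is only meaningful when the rows are numerous enough: at least
   [n0 s d] of them. *)
Definition soft_Omega (n0 : nat -> nat -> nat)
    (T : nat -> nat -> nat -> nat -> \bar R)
    (f : nat -> nat -> nat -> nat) : Prop :=
  exists (C : R) (k : nat), 0 < C /\ forall s n d L : nat,
    (2 <= s)%N -> (0 < n)%N -> (0 < d)%N -> (0 < L)%N -> (n0 s d <= n)%N ->
    ((C * (f s d L)%:R / logpow k s n d L)%:E <= T s n d L)%E.

Definition soft_Theta (n0 : nat -> nat -> nat)
    (T : nat -> nat -> nat -> nat -> \bar R)
    (f : nat -> nat -> nat -> nat) : Prop :=
  soft_O T f /\ soft_Omega n0 T f.

End Complexity.

(* Each server can hold d rows. *)
Definition rows_all_servers (s d : nat) : nat := (s * d)%N.

(* One server can hold d rows and each of the others one row. *)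
Definition rows_one_server (s d : nat) : nat := (s + d).-1.

(* Main.v *)
Require Import Defs.
From mathcomp Require Import all_boot all_order all_algebra.
From mathcomp Require Import all_classical all_reals all_analysis.
From mathcomp Require Import perm zify ring lra.

(* Upper bounds.  The solution set depends only on the row span of [A b].  So
   each server can send a basis of its rows (deterministic, coordinator), or, on
   the blackboard, only rows outside the span of what is already written.  In the
   randomized coordinator protocol the coordinator sends each server a random
   vector orthogonal, modulo a random prime, to the rows collected so far; a
   server answers with its first row that is not orthogonal to it.  Tests have
   one-sided error and, unless one fails, the rows collected are the greedy basis
   in the order of the servers, so a union bound over at most d + 1 fixed tests
   suffices.

   Lower bounds.  The term d^2 L counts outputs: there are 2^Omega(d^2 L) systems
   with distinct unique solutions, and if all the servers must hold the same such
   system, a deterministic coordinator needs as many bits on every channel.  The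
   term s holds because each server must speak.  For the term s d, one server
   fixes x = a in {0,1}^d and every other one holds a single equation
   (v - v') x = 0; an equation violated because <a, v + v'> is odd must be
   detected, and inner product modulo 2 has exponentially small discrepancy.  As
   <a, v> = <a, v'> only with probability at least 1 / (d + 1), the error has to
   be reduced to O(1/d), which costs a factor log d. *)

Set Implicit Arguments.
Unset Strict Implicit.
Unset Printing Implicit Defensive.

Import Order.TTheory GRing.Theory Num.Theory.
Local Open Scope ring_scope.

(** * Reductions between models *)

(** Only the randomized coordinator bounds lose a logarithm; in the other three cases both
    directions hold up to constants. Randomized upper bounds are obtained for private coins and
    lower bounds for public ones, which covers both values of [coins]. Over the reals an orthogonal
    vector may need about d L bits per entry, so querying s servers would cost s d^2 L; modulo a
    prime of O(log(dL)) bits a query costs O(d log(dL)). No single prime is safe, as the rank of the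
    input may drop modulo it, but the primes that lower it divide one nonzero minor and are few. For
    s d, channel lengths are averaged over feasible inputs, those on which acceptance is guaranteed.
    This correlates [a] with the checks, at the price of a factor d + 1. The error reduction that
    pays for it is not applied to the protocol: the acceptance probability, restricted to runs in
    which one chosen channel is short, is a mixture of rectangles, and so are its powers. *)

Section FixingData.
Variables (s : nat) (X0 X Y O : Type).

Definition coord_fix (P : coord_protocol s X0 Y O) (x0 : X0)
    (f : 'I_s -> X -> Y) : coord_protocol s unit X O :=
  CoordProtocol (fun _ h => coord_next P x0 h)
    (fun i x ch => coord_reply P i (f i x) ch).

Definition board_fix (P : board_protocol s X0 Y O) (x0 : X0)
    (f : 'I_s -> X -> Y) : board_protocol s unit X O :=
  BoardProtocol (board_turn P) (fun _ h => board_coord P x0 h)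
    (fun i x h => board_server P i (f i x) h) (fun _ h => board_output P x0 h).

Definition protocol_fix (m : model) :
    protocol m s X0 Y O -> X0 -> ('I_s -> X -> Y) -> protocol m s unit X O :=
  match m with
  | coordinator_model => coord_fix
  | blackboard_model => board_fix
  end.

Lemma run_fix (m : model) (P : protocol m s X0 Y O) x0 f (x : 'I_s -> X) c :
  run (protocol_fix P x0 f) tt x c = run P x0 (fun i => f i (x i)) c.
Proof.
case: m P => P /=.
- elim: c [::] => [|c IH] h /=; first by case: coord_next.
  by case: coord_next => [i a|i|o] //; rewrite IH.
- elim: c [::] => [|c IH] h /=; first by case: board_turn => [[|i]|].
  by case: board_turn => [[|i]|] //; rewrite IH.
Qed.

End FixingData.

Section IgnoringCoins.
Variables (s : nat) (W X0 X O : Type) (f : W -> X0).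

(** With [f] constant this adds coins to a deterministic protocol; with [f] the identity it leaves
    all the randomness to the coordinator. *)
Definition protocol_uncoin (m : model) :
    protocol m s X0 X O -> protocol m s W (X * W) O :=
  match m with
  | coordinator_model => fun P =>
      CoordProtocol (fun w h => coord_next P (f w) h)
        (fun i x ch => coord_reply P i x.1 ch)
  | blackboard_model => fun P =>
      BoardProtocol (board_turn P) (fun w h => board_coord P (f w) h)
        (fun i x h => board_server P i x.1 h) (fun w h => board_output P (f w) h)
  end.

Lemma run_uncoin (m : model) (P : protocol m s X0 X O) w (u : 'I_s -> W) x c :
  run (protocol_uncoin P) w (fun i => (x i, u i)) c = run P (f w) x c.
Proof.
case: m P => P /=.
- elim: c [::] => [|c IH] h /=; first by case: coord_next.
  by case: coord_next => [i a|i|o] //; rewrite IH.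
- elim: c [::] => [|c IH] h /=; first by case: board_turn => [[|i]|].
  by case: board_turn => [[|i]|] //; rewrite IH.
Qed.

End IgnoringCoins.

Section Solvability.
Variable R : realType.
Implicit Types (s n d L c : nat) (m : model).

Lemma proba_true (W : finType) (E : W -> Prop) :
  (0 < #|W|)%N -> (forall w, E w) -> proba R E = 1.
Proof.
move=> W0 EW; rewrite /proba (_ : #|_| = #|W|) ?divff ?pnatr_eq0 -?lt0n //.
by apply: eq_card => w; rewrite !inE; apply/asboolP.
Qed.

Lemma le_proba (W : finType) (E E' : W -> Prop) :
  (forall w, E w -> E' w) -> proba R E <= proba R E'.
Proof.
move=> EE'; rewrite /proba ler_wpM2r ?invr_ge0 ?ler0n // ler_nat.
apply/subset_leq_card/fintype.subsetP => w; rewrite !unfold_in => /asboolP Ew.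
by apply/asboolP; apply: EE'.
Qed.

Lemma randomly_of_deterministically m s n d L c :
  deterministically_solvable R m s n d L c ->
  randomly_solvable R private_coins m s n d L c.
Proof.
case=> P PH; exists unit, (protocol_uncoin (fun=> tt) P) => I bI /=.
have [ans rans cans] := PH I bI.
split=> [w|]; first by rewrite run_uncoin rans.
rewrite proba_true ?ler_pdivrMr ?mul1r ?ltr0n ?ler_nat // => [|w].
  by rewrite card_prod card_unit card_ffun card_unit exp1n.
by exists ans; rewrite ?run_uncoin.
Qed.

(** The public coin is the whole tuple of private coins, each party's share being built into the
    protocol. *)
Lemma public_of_private m s n d L c :
  randomly_solvable R private_coins m s n d L c ->
  randomly_solvable R public_coins m s n d L c.
Proof.
case=> W [P PH]; exists (W * {ffun 'I_s -> W})%type.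
exists (fun w : (W * {ffun 'I_s -> W})%type =>
  protocol_fix P w.1 (fun i (x : seq 'rV[int]_(d + 1)) => (x, w.2 i))).
move=> I bI; have [h1 h2] := PH I bI; split=> [w|]; first by rewrite run_fix.
by apply: le_trans h2 (le_proba _) => w; rewrite run_fix.
Qed.

Lemma randomly_of_private k m s n d L c :
  randomly_solvable R private_coins m s n d L c ->
  randomly_solvable R k m s n d L c.
Proof. by case: k => //; apply: public_of_private. Qed.

Lemma public_of_randomly k m s n d L c :
  randomly_solvable R k m s n d L c ->
  randomly_solvable R public_coins m s n d L c.
Proof. by case: k => //; apply: public_of_private. Qed.

End Solvability.

Section BoardOfCoord.
Variables (s : nat) (X O : Type).
Variable P : coord_protocol s unit X (option O).

(* As the coordinator has no private data, its history can be replayed by all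
   from the bits alone. *)
Definition replay_step (h : seq ('I_s * (direction * bool))) (b : bool) :=
  match coord_next P tt h with
  | Tell i _ => rcons h (i, (to_server, b))
  | Ask i => rcons h (i, (to_coordinator, b))
  | Output _ => h
  end.

Definition replay := foldl replay_step [::].

Lemma replay_rcons h b : replay (rcons h b) = replay_step (replay h) b.
Proof. by rewrite /replay foldl_rcons. Qed.

Definition board_of_coord : board_protocol s unit X (option O) :=
  BoardProtocol
    (fun h => match coord_next P tt (replay h) with
              | Tell _ _ => Some (Coordinator s)
              | Ask i => Some (Server i)
              | Output _ => None
              end)
    (fun _ h => if coord_next P tt (replay h) is Tell _ a then a else false)
    (fun i x h => coord_reply P i x (channel i (replay h)))
    (fun _ h => if coord_next P tt (replay h) is Output o then o else None).

Lemma run_board_of_coord x c :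
  board_run_from board_of_coord tt x c [::] = coord_run_from P tt x c [::].
Proof.
rewrite -[in RHS](erefl : replay [::] = [::]).
elim: c [::] => [|c IH] h /=; first by case: coord_next.
case E: coord_next => [i a|i|o] //.
  by rewrite IH replay_rcons /replay_step E.
by rewrite IH replay_rcons /replay_step E.
Qed.

End BoardOfCoord.

Lemma blackboard_of_coordinator (R : realType) s n d L c :
  randomly_solvable R public_coins coordinator_model s n d L c ->
  randomly_solvable R public_coins blackboard_model s n d L c.
Proof.
case=> W [P PH]; exists W, (fun w => board_of_coord (P w)) => I bI.
have [h1 h2] := PH I bI; split=> [w|] /=; first by rewrite run_board_of_coord; apply: h1.
apply: le_trans h2 _; apply: le_proba => w.
by rewrite /= run_board_of_coord.
Qed.

(** * From costs of protocols to soft bounds *)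

Section SoftBounds.
Variable R : realType.
Implicit Types (solv : nat -> nat -> nat -> nat -> nat -> Prop).

Lemma soft_O_of_protocols solv (f : nat -> nat -> nat -> nat) (C : R) (k : nat) :
  (forall s n d L, (2 <= s)%N -> (0 < n)%N -> (0 < d)%N -> (0 < L)%N ->
    exists2 c, solv s n d L c & c%:R <= C * (f s d L)%:R * logpow R k s n d L) ->
  soft_O (fun s n d L => least_cost R (solv s n d L)) f.
Proof.
move=> H; exists C, k => s n d L s2 n0 d0 L0.
have [c sc cle] := H s n d L s2 n0 d0 L0.
apply: (@le_trans _ _ (c%:R)%:E); last by rewrite lee_fin.
by apply: ereal_inf_lbound; exists c.
Qed.

Lemma soft_Omega_of_costs n0 solv (f : nat -> nat -> nat -> nat) (C : R) (k : nat) :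
  0 < C ->
  (forall s n d L c, (2 <= s)%N -> (0 < n)%N -> (0 < d)%N -> (0 < L)%N ->
    (n0 s d <= n)%N -> solv s n d L c ->
    C * (f s d L)%:R / logpow R k s n d L <= c%:R) ->
  soft_Omega n0 (fun s n d L => least_cost R (solv s n d L)) f.
Proof.
move=> C0 H; exists C, k; split=> // s n d L s2 n_gt0 d0 L0 hn.
apply: le_ereal_inf_tmp => _ /= [c sc <-]; rewrite lee_fin.
exact: H.
Qed.

End SoftBounds.

(** * Counting primes *)

Section PrimeCounting.
Local Open Scope nat_scope.

Lemma leq_exp2_bin2n n : 2 ^ n <= 'C(n.*2, n).
Proof.
elim: n => [|n IH] //; rewrite doubleS binS.
have -> : 'C(n.*2.+1, n) = 'C(n.*2.+1, n.+1).
  by rewrite -[LHS]bin_sub; [congr binomial; lia | lia].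
by rewrite addnn -mul2n expnS leq_mul2l /= (leq_trans IH) // binS leq_addl.
Qed.

(** By Legendre's formula the exponent of [p] is the sum over [k] of [2n %/ p^k - 2 (n %/ p^k)].
    Each term is 0 or 1 and vanishes when [p^k > 2n], so the exponent is at most the logarithm of
    [2n] to base [p]. *)
Lemma expn_logn_bin2n p n : prime p -> 0 < n -> p ^ logn p 'C(n.*2, n) <= n.*2.
Proof.
move=> pp n0.
have n20 : 0 < n.*2 by rewrite double_gt0.
apply: leq_trans (trunc_logP (prime_gt1 pp) n20).
rewrite leq_exp2l ?prime_gt1 //.
have facE : n.*2`! = 'C(n.*2, n) * (n`! * n`!).
  by rewrite -(@bin_fact n.*2 n); [congr (_ * (_ * _`!)); lia | lia].
have Cgt0 : 0 < 'C(n.*2, n) by rewrite bin_gt0; lia.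
have := congr1 (logn p) facE.
rewrite !lognM ?muln_gt0 ?fact_gt0 // !logn_fact //.
have -> : \sum_(1 <= k < n.+1) n %/ p ^ k = \sum_(1 <= k < n.*2.+1) n %/ p ^ k.
  rewrite [RHS](big_cat_nat (n := n.+1)) //=; last lia.
  rewrite -[LHS]addn0; congr addn; apply/esym.
  rewrite big_nat_cond big1 // => k; rewrite andbT => /andP[nk _].
  by rewrite divn_small // (leq_trans nk) // ltnW // ltn_expl // prime_gt1.
set l := trunc_log p n.*2; rewrite -big_split /= => E.
have : \sum_(1 <= k < n.*2.+1) n.*2 %/ p ^ k <=
       \sum_(1 <= k < n.*2.+1) (n %/ p ^ k + n %/ p ^ k + (k <= l)).
  rewrite big_nat_cond [X in _ <= X]big_nat_cond; apply: leq_sum => k.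
  rewrite andbT => /andP[k1 _].
  have pk0 : 0 < p ^ k by rewrite expn_gt0 prime_gt0.
  have [kl|lk] := leqP k l.
    rewrite -ltnS ltn_divLR //.
    have := ltn_ceil n pk0; lia.
  rewrite divn_small //.
  by apply: leq_trans (leq_pexp2l (prime_gt0 pp) lk); apply: trunc_log_ltn; apply: prime_gt1.
rewrite big_split /= E addnC leq_add2l.
suff -> : \sum_(1 <= k < n.*2.+1) (k <= l) = l by [].
have ll : l <= n.*2.
  have := trunc_logP (prime_gt1 pp) n20; rewrite -/l => h.
  exact: leq_trans (ltnW (ltn_expl _ (prime_gt1 pp))) h.
rewrite (big_cat_nat (n := l.+1)) //=.
rewrite [X in X + _ = _](eq_big_nat _ _ (F2 := fun=> 1)); last by move=> k; rewrite ltnS => /andP[_ ->].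
rewrite [X in _ + X = _]big1_seq ?addn0; last first.
  by move=> k /=; rewrite mem_index_iota => /andP[lk _]; rewrite leqNgt lk.
by rewrite sum_nat_const_nat; lia.
Qed.

(** Erdős's argument with [n = 2 ^ (2q)]: the central binomial coefficient is at least [2 ^ n] and
    is a product of prime powers, each at most [2n = 2 ^ (2q + 1)], so it has at least
    [n / (2q + 1)] prime divisors. For [q > 2], [2q + 1 <= 2 ^ q]. *)
Lemma many_primes q : 2 < q ->
  exists ps : seq nat, [/\ uniq ps, all prime ps,
    all (fun p => p <= 2 ^ q.*2.+1) ps & 2 ^ q <= size ps].
Proof.
move=> q3; pose n := 2 ^ q.*2.
have n0 : 0 < n by rewrite expn_gt0.
have n2E : n.*2 = 2 ^ q.*2.+1 by rewrite expnS mul2n.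
have Cgt0 : 0 < 'C(n.*2, n) by rewrite bin_gt0; lia.
have le_pow p : p \in primes 'C(n.*2, n) -> p ^ logn p 'C(n.*2, n) <= n.*2.
  by rewrite mem_primes => /andP[pp _]; apply: expn_logn_bin2n.
exists (primes 'C(n.*2, n)); split; first exact: primes_uniq.
- by apply/allP => p; rewrite mem_primes => /andP[].
- apply/allP => p pC; rewrite -n2E; apply: leq_trans (le_pow p pC).
  rewrite -[X in X <= _]expn1 leq_pexp2l //.
    by move: pC; rewrite mem_primes => /andP[/prime_gt0].
  by rewrite logn_gt0.
have : 'C(n.*2, n) <= n.*2 ^ size (primes 'C(n.*2, n)).
  rewrite {1}(prod_prime_decomp Cgt0) prime_decompE big_map /=.
  rewrite -[X in _ ^ X]sum1_size expn_sum big_seq [X in _ <= X]big_seq.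
  by apply: leq_prod => p pC; rewrite expn1 le_pow.
move=> /(leq_trans (leq_exp2_bin2n n)); rewrite n2E -expnM leq_exp2l // => h.
have le2q : q.*2.+1 <= 2 ^ q.
  elim: q q3 {n n0 n2E Cgt0 le_pow h} => // q IH; rewrite ltnS leq_eqVlt => /orP[/eqP <- //|q3].
  by have := IH q3; rewrite doubleS expnS; lia.
rewrite -(leq_pmul2l (m := q.*2.+1)) //; apply: leq_trans h.
by rewrite /n -[X in _ <= _ ^ X]addnn expnD leq_mul2r le2q orbT.
Qed.

End PrimeCounting.

(** * Bits, rank and spans over different fields *)

Section Encoding.

Fixpoint to_bits (k x : nat) : seq bool :=
  if k is k'.+1 then odd x :: to_bits k' x./2 else [::].

Definition of_bits : seq bool -> nat := foldr (fun (b : bool) x => (b + x.*2)%N) 0%N.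

Lemma size_to_bits k x : size (to_bits k x) = k.
Proof. by elim: k x => //= k IH x; rewrite IH. Qed.

Lemma to_bitsK k x : (x < 2 ^ k)%N -> of_bits (to_bits k x) = x.
Proof.
elim: k x => [|k IH] x /=; first by rewrite ltnS leqn0 => /eqP ->.
rewrite expnS => h; rewrite IH ?odd_double_half //; lia.
Qed.

Definition enc_nats k (xs : seq nat) : seq bool :=
  flatten [seq to_bits k x | x <- xs].

Definition dec_nats k n (bs : seq bool) : seq nat :=
  [seq of_bits c | c <- reshape (nseq n k) bs].

Lemma size_enc_nats k xs : size (enc_nats k xs) = (size xs * k)%N.
Proof.
elim: xs => //= x xs IH.
by rewrite /enc_nats /= size_cat size_to_bits -/(enc_nats k xs) IH mulSn.
Qed.

Lemma enc_natsK k xs : all (fun x => x < 2 ^ k)%N xs ->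
  dec_nats k (size xs) (enc_nats k xs) = xs.
Proof.
move=> /allP xs_lt; rewrite /dec_nats /enc_nats.
have -> : nseq (size xs) k = shape [seq to_bits k x | x <- xs].
  by elim: xs {xs_lt} => //= x xs ->; rewrite size_to_bits.
rewrite flattenK -map_comp -[RHS]map_id; apply/eq_in_map => x /xs_lt.
exact: to_bitsK.
Qed.

Variables (w L : nat).

Definition bounded_row (r : 'rV[int]_w) := forall j, `|r 0 j| <= 2 ^+ L.

(** The shift makes the entries natural numbers up to [2 ^ (L + 1)] inclusive, which fit in [L + 2]
    bits. *)
Definition enc_row (r : 'rV[int]_w) : seq bool :=
  enc_nats (L + 2) [seq absz (r 0 j + 2 ^+ L) | j <- enum 'I_w].

Definition dec_row (bs : seq bool) : 'rV[int]_w :=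
  \row_j ((nth 0%N (dec_nats (L + 2) w bs) j)%:Z - 2 ^+ L).

Lemma size_enc_row r : size (enc_row r) = (w * (L + 2))%N.
Proof. by rewrite /enc_row size_enc_nats size_map size_enum_ord. Qed.

Lemma powZE : (2 ^+ L : int) = (2 ^ L)%N%:Z.
Proof. by elim: L => // k IH; rewrite exprS IH expnS PoszM. Qed.

Lemma enc_rowK r : bounded_row r -> dec_row (enc_row r) = r.
Proof.
move=> br; apply/rowP => j; rewrite mxE /enc_row.
have -> : dec_nats (L + 2) w (enc_nats (L + 2)
    [seq absz (r 0 j + 2 ^+ L) | j <- enum 'I_w]) =
    [seq absz (r 0 j + 2 ^+ L) | j <- enum 'I_w].
  rewrite -{1}(size_enum_ord w) -(size_map (fun j => absz (r 0 j + 2 ^+ L))).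
  apply: enc_natsK; apply/allP => _ /mapP[i _ ->].
  have := br i; rewrite addn2 !expnS.
  rewrite powZE; lia.
rewrite (nth_map j) ?size_enum_ord // nth_ord_enum.
have := br j.
by rewrite powZE => h; rewrite gez0_abs ?addrK //; lia.
Qed.

End Encoding.

Section IntegerRank.
Implicit Types (F : fieldType).

Lemma rank_minor F n w (M : 'M[F]_(n, w)) :
  exists (f : 'I_(\rank M) -> 'I_n) (g : 'I_(\rank M) -> 'I_w),
    \det (mxsub f g M) != 0.
Proof.
have fullT : row_full (rowsub (maxrankfun M) M)^T.
  by rewrite /row_full mxrank_tr -/(row_free _) maxrowsub_free.
move: (fullrankfun fullT) (fullrowsub_unit fullT) => g.
rewrite unitmxE unitfE => h; exists (maxrankfun M), g; move: h.
by rewrite -trmx_mxsub det_tr -mxsubcr.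
Qed.

Lemma minor_rank F n w r (M : 'M[F]_(n, w)) (f : 'I_r -> 'I_n) (g : 'I_r -> 'I_w) :
  \det (mxsub f g M) != 0 -> (r <= \rank M)%N.
Proof.
rewrite -unitfE -unitmxE => /mxrank_unit <-.
rewrite mxsubrc rowsubE -[M in colsub g M]mulmx1 -mulmx_colsub.
by apply: leq_trans (mxrankM_maxr _ _) _; apply: mxrankM_maxl.
Qed.

(* A nonzero minor over [F1] is a nonzero integer, hence nonzero over [F2]. *)
Lemma rank_transfer F1 F2 n w (A : 'M[int]_(n, w)) :
  (forall D : int, D%:~R != 0 :> F1 -> D%:~R != 0 :> F2) ->
  (\rank (map_mx intr A : 'M[F1]_(n, w)) <=
   \rank (map_mx intr A : 'M[F2]_(n, w)))%N.
Proof.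
move=> H; have [f [g]] := rank_minor (map_mx intr A : 'M[F1]_(n, w)).
rewrite -map_mxsub det_map_mx => /H; rewrite -det_map_mx map_mxsub.
exact: minor_rank.
Qed.

Lemma Fp_intr_eq0 p (D : int) : prime p -> (D%:~R == 0 :> 'F_p) = (p %| `|D|)%N.
Proof. by move=> pp; rewrite -(dvdz_pcharf (pchar_Fp pp)). Qed.

Lemma absz_det_le r (B : nat) (M : 'M[int]_r) :
  (forall i j, `|M i j|%N <= B)%N -> (`|\det M| <= r`! * B ^ r)%N.
Proof.
move=> MB; rewrite -lez_nat abszE /determinant.
apply: le_trans (ler_norm_sum _ _ _) _.
have -> : (r`! * B ^ r)%N%:Z = \sum_(s : 'S_r) (B ^ r)%N%:Z.
  by rewrite sumr_const card_Sn -mulr_natl natz PoszM.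
apply: ler_sum => s _; rewrite normrM normrX normrN1 expr1n mul1r normr_prod.
have -> : (B ^ r)%N%:Z = \prod_(i < r) B%:Z.
  by rewrite prodr_const card_ord; elim: r {M MB s} => // r IH; rewrite expnS PoszM IH exprS.
by apply: ler_prod => i _; rewrite normr_ge0 -abszE lez_nat MB.
Qed.

(* [D] is a maximal nonzero minor. *)
Lemma rank_drop_divisor (R : realType) n w (B : nat) (A : 'M[int]_(n, w)) :
  (0 < B)%N -> (forall i j, `|A i j|%N <= B)%N ->
  exists D : nat, [/\ (0 < D)%N, (D <= w`! * B ^ w)%N &
    forall p, prime p -> ~~ (p %| D)%N ->
      (\rank (map_mx intr A : 'M[R]_(n, w)) <=
       \rank (map_mx intr A : 'M['F_p]_(n, w)))%N].
Proof.
move=> B0 AB; have [f [g]] := rank_minor (map_mx intr A : 'M[R]_(n, w)).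
rewrite -map_mxsub det_map_mx intr_eq0 => D0.
set D := \det _ in D0.
exists `|D|%N; split; first by rewrite absz_gt0.
  apply: leq_trans (absz_det_le (B := B) _) _ => [i j|]; first by rewrite mxE.
  have rw := rank_leq_col (map_mx intr A : 'M[R]_(n, w)).
  by rewrite leq_mul ?leq_pexp2l // leq_fact.
move=> p pp; rewrite -Fp_intr_eq0 // /D -det_map_mx map_mxsub.
exact: minor_rank.
Qed.

End IntegerRank.

Section Spans.
Variable w : nat.
Implicit Types (r : 'rV[int]_w) (rs : seq 'rV[int]_w) (F : fieldType).

Fixpoint rows_mx rs : 'M[int]_(size rs, w) :=
  match rs with
  | [::] => 0
  | r :: rs' => col_mx r (rows_mx rs')
  end.

(** Rows stay integral and only the test casts them to [F], so that the same list can be compared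
    over [R] and over ['F_p]. *)
Definition inspan F rs r : bool :=
  (map_mx intr r <= map_mx (intr : int -> F) (rows_mx rs))%MS.

Definition indep F rs : bool :=
  \rank (map_mx (intr : int -> F) (rows_mx rs)) == size rs.

Lemma map_rows_cons F r rs :
  (map_mx (intr : int -> F) (rows_mx (r :: rs)) :=:
   map_mx intr r + map_mx intr (rows_mx rs))%MS.
Proof.
apply/eqmx_sym/(eqmx_trans (addsmxE _ _)).
by rewrite -map_col_mx; apply: eqmx_refl.
Qed.

Lemma inspan_head F r rs : inspan F (r :: rs) r.
Proof. by rewrite /inspan map_rows_cons addsmxSl. Qed.

Lemma inspan_behead F r r' rs : inspan F rs r -> inspan F (r' :: rs) r.
Proof.
rewrite /inspan map_rows_cons => h.
exact: submx_trans h (addsmxSr _ _).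
Qed.

Lemma inspan_mem F r rs : r \in rs -> inspan F rs r.
Proof.
elim: rs => // r' rs IH; rewrite inE => /orP[/eqP ->|/IH]; first exact: inspan_head.
exact: inspan_behead.
Qed.

Lemma rows_mx_sub F m rs (M : 'M[F]_(m, w)) :
  (map_mx intr (rows_mx rs) <= M)%MS =
  all (fun r => (map_mx intr r <= M)%MS) rs.
Proof.
elim: rs => [|r rs IH] /=; first by rewrite map_mx0 sub0mx.
by rewrite map_rows_cons addsmx_sub IH.
Qed.

Lemma inspan_trans F rs rs' r :
  all (inspan F rs) rs' -> inspan F rs' r -> inspan F rs r.
Proof. by rewrite -rows_mx_sub => h h'; apply: submx_trans h' h. Qed.

Lemma indep_cons F r rs : indep F rs -> ~~ inspan F rs r -> indep F (r :: rs).
Proof.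
rewrite /indep /inspan => /eqP rk h.
rewrite eqn_leq rank_leq_row /= map_rows_cons -[X in (X < _)%N]rk ltn_neqAle.
rewrite (mxrank_leqif_sup (addsmxSr _ _)) addsmx_sub negb_and h /=.
by rewrite mxrankS // addsmxSr.
Qed.

Lemma indep_size F rs : indep F rs -> (size rs <= w)%N.
Proof. by move=> /eqP <-; apply: rank_leq_col. Qed.

End Spans.

Section Solving.
Variable R : realType.

Definition inrow (s n d : nat) (I : linsys s n d) (j : 'I_n) : 'rV[int]_(d + 1) :=
  row j (row_mx (lhs I) (rhs I)).

(** The equation is put in homogeneous form, a row of [[A b]] against the vector [(x, -1)]: it is
    then linear in the row and passes to spans. *)
Definition solves d (x : 'cV[R]_d) (r : 'rV[int]_(d + 1)) : Prop :=
  map_mx intr r *m col_mx x (- 1%:M) = 0.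

Lemma solution_rows s n d (I : linsys s n d) (x : 'cV[R]_d) :
  solution I x <-> forall j, solves x (inrow I j).
Proof.
have rowE j : map_mx intr (inrow I j) *m col_mx x (- 1%:M) =
    row j (map_mx intr (lhs I) *m x - map_mx intr (rhs I)).
  rewrite /inrow map_row map_row_mx -row_mul; congr (row j _).
  by rewrite mul_row_col mulmxN mulmx1.
rewrite /solution; split=> [e j|e]; first by rewrite /solves rowE e subrr row0.
apply/eqP; rewrite -subr_eq0; apply/eqP/row_matrixP => j.
by rewrite -rowE e row0.
Qed.

Lemma solves_span d (x : 'cV[R]_d) rs r :
  (forall r', r' \in rs -> solves x r') -> inspan R rs r -> solves x r.
Proof.
move=> h /submxP[D rE]; rewrite /solves rE -mulmxA.
suff -> : map_mx intr (rows_mx rs) *m col_mx x (- 1%:M) = 0 by rewrite mulmx0.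
elim: rs h {D rE} => [|r' rs IH] h; first by rewrite map_mx0 mul0mx.
rewrite [rows_mx _]/= (map_col_mx _ r' (rows_mx rs)) (mul_col_mx (map_mx _ r')).
rewrite IH => [|r'' r''rs]; last by apply: h; rewrite inE r''rs orbT.
have := h r' (mem_head _ _); rewrite /solves => ->.
by rewrite col_mx0.
Qed.

(** Local computation is free, so the answer may be picked by choice. *)
Definition solve d (rs : seq 'rV[int]_(d + 1)) : option 'cV[R]_d :=
  if pselect (exists x : 'cV[R]_d, forall r, r \in rs -> solves x r) is left ex
  then Some (projT1 (cid ex)) else None.

(** Rows taken from [I] impose nothing beyond [I], and rows spanning it impose all of it. The zero
    rows allow for padding. *)
Lemma correct_solve s n d (I : linsys s n d) rs :
  (forall r, r \in rs -> r = 0 \/ exists j, r = inrow I j) ->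
  (forall j, inspan R rs (inrow I j)) -> correct I (solve rs).
Proof.
move=> rsI Irs; rewrite /solve; case: pselect => [ex|nex] /=.
  case: (cid ex) => x xrs /=; apply/solution_rows => j.
  exact: solves_span xrs (Irs j).
case=> x /solution_rows xI; apply: nex; exists x => r /rsI[->|[j ->]]; last exact: xI.
by rewrite /solves map_mx0 mul0mx.
Qed.

Lemma mem_held s n d (I : linsys s n d) i r :
  r \in held I i -> exists j, r = inrow I j.
Proof. by case/mapP => j _ ->; exists j. Qed.

Lemma inrow_held s n d (I : linsys s n d) j : inrow I j \in held I (holder I j).
Proof. by apply: map_f; rewrite mem_filter eqxx mem_enum. Qed.

Lemma bounded_held s n d L (I : linsys s n d) i r :
  entries_bounded L I -> r \in held I i -> bounded_row L r.
Proof.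
case=> hl hr /mem_held[j ->] k; rewrite /inrow mxE.
by case: (split_ordP k) => k' ->; rewrite ?row_mxEl ?row_mxEr // (ord1 k').
Qed.

Lemma held_ext s n d (I J : linsys s n d) i : holder I = holder J ->
  (forall j, holder J j = i -> inrow I j = inrow J j) -> held I i = held J i.
Proof.
move=> hIJ IJ; rewrite /held hIJ; apply/eq_in_map => j.
by rewrite mem_filter => /andP[/eqP ji _]; apply: IJ.
Qed.

End Solving.

(** * Protocol trees *)

Section Greedy.
Variables (F : fieldType) (w : nat).
Implicit Types (V X : seq 'rV[int]_w).

(** The reference run: the blackboard protocol computes this list over [R], the hashing protocol
    over ['F_p] unless a test fails. *)
Fixpoint greedy V X :=
  if X is r :: X' then greedy (if inspan F V r then V else r :: V) X' else V.

Definition fresh V X := [seq r <- X | ~~ inspan F V r].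

Lemma greedy_indep V X : indep F V -> indep F (greedy V X).
Proof.
elim: X V => //= r X IH V iV; apply: IH; case: ifPn => // rV.
exact: indep_cons.
Qed.

Lemma greedy_inspanl V X r : inspan F V r -> inspan F (greedy V X) r.
Proof.
elim: X V => //= r' X IH V rV; apply: IH; case: ifP => // _.
exact: inspan_behead.
Qed.

Lemma greedy_inspanr V X r : r \in X -> inspan F (greedy V X) r.
Proof.
elim: X V => //= r' X IH V; rewrite inE => /orP[/eqP ->|/IH //].
by apply: greedy_inspanl; case: ifP => // _; apply: inspan_head.
Qed.

Lemma greedy_mem V X r : r \in greedy V X -> r \in V \/ r \in X.
Proof.
elim: X V => /= [|r' X IH] V; first by left.
move=> /IH[|rX]; last by right; rewrite inE rX orbT.
case: ifP => _; first by left.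
by rewrite !inE => /orP[->|->]; [right|left].
Qed.

Lemma greedy_cat V X X' : greedy V (X ++ X') = greedy (greedy V X) X'.
Proof. by elim: X V => //= r X IH V; rewrite IH. Qed.

Lemma greedy_size V X : (size V <= size (greedy V X))%N.
Proof.
elim: X V => //= r X IH V; apply: leq_trans (IH _); case: ifP => //= _.
Qed.

Lemma greedy_fresh0 V X : fresh V X = [::] -> greedy V X = V.
Proof.
elim: X V => //= r X IH V; rewrite /fresh /=.
by case: ifP => //= /negbFE ->; apply: IH.
Qed.

(** The rows of [X] before [r] lie in the span of [V], so adding [r] ahead of time does not change
    what is kept. *)
Lemma greedy_fresh V X r Y : fresh V X = r :: Y ->
  greedy V X = greedy (r :: V) X.
Proof.
elim: X V => //= a X IH V; rewrite /fresh /=; case: ifPn => /= aV.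
  by case=> <- _; rewrite (negbTE aV) inspan_head.
move=> /IH; move: aV; rewrite negbK => aV; rewrite aV => ->.
by rewrite (inspan_behead r aV).
Qed.

Lemma fresh_head V X r Y : fresh V X = r :: Y -> r \in X /\ ~~ inspan F V r.
Proof.
move=> e; have : r \in fresh V X by rewrite e mem_head.
by rewrite mem_filter => /andP[].
Qed.

End Greedy.

Section Channels.
Variable s : nat.
Implicit Types (i j : 'I_s) (h : seq ('I_s * (direction * bool))).

Lemma channel_cat i h h' : channel i (h ++ h') = channel i h ++ channel i h'.
Proof. by rewrite /channel filter_cat map_cat. Qed.

Lemma channel_own i ms : channel i [seq (i, m) | m <- ms] = ms.
Proof.
rewrite /channel filter_map (eq_filter (a2 := predT)) ?filter_predT => [|m] /=.
  by rewrite -map_comp map_id.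
by rewrite eqxx.
Qed.

Lemma channel_other i j ms : i != j -> channel j [seq (i, m) | m <- ms] = [::].
Proof.
move=> ij; rewrite /channel filter_map (eq_filter (a2 := pred0)) ?filter_pred0 // => m /=.
exact: negbTE.
Qed.

Lemma channel_rcons i h m : channel i (rcons h (i, m)) = rcons (channel i h) m.
Proof. by rewrite -!cats1 channel_cat (channel_own i [:: m]). Qed.

End Channels.

Section CoordTrees.
Variables (s : nat) (X0 X O : Type).

(** Trees let a protocol be written as a program with continuations; [coord_of_tree] finds the
    current node by walking along the history. A server does not see that node, so its replies are
    kept apart from the tree. *)
Inductive ctree :=
  | COut of O
  | CTell of 'I_s & bool & ctree
  | CAsk of 'I_s & (bool -> ctree).

Definition cstep (t : ctree) (e : 'I_s * (direction * bool)) : ctree :=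
  match t with
  | COut o => COut o
  | CTell _ _ t' => t'
  | CAsk _ k => k e.2.2
  end.

Definition coord_of_tree (T : X0 -> ctree)
    (reply : 'I_s -> X -> seq (direction * bool) -> bool) :=
  CoordProtocol (fun x0 h => match foldl cstep (T x0) h with
                             | COut o => Output s o
                             | CTell i a _ => Tell O i a
                             | CAsk i _ => Ask O i
                             end) reply.

Variables (reply : 'I_s -> X -> seq (direction * bool) -> bool) (x : 'I_s -> X).

Fixpoint ceval (t : ctree) h : O * nat :=
  match t with
  | COut o => (o, 0%N)
  | CTell i a t' =>
      let e := ceval t' (rcons h (i, (to_server, a))) in (e.1, e.2.+1)
  | CAsk i k =>
      let a := reply i (x i) (channel i h) in
      let e := ceval (k a) (rcons h (i, (to_coordinator, a))) in (e.1, e.2.+1)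
  end.

Lemma run_coord_of_tree T x0 c : ((ceval (T x0) [::]).2 <= c)%N ->
  coord_run_from (coord_of_tree T reply) x0 x c [::] =
  Some (ceval (T x0) [::]).1.
Proof.
have: foldl cstep (T x0) [::] = T x0 by [].
elim: {2 3 4}(T x0) [::] c => [out|i a t IH|i k IH] h c /= E.
- by case: c => [|c] _ /=; rewrite E.
- by case: c => // c h1; rewrite /= E; apply: IH => //; rewrite foldl_rcons E.
- by case: c => // c h1; rewrite /= E; apply: IH => //; rewrite foldl_rcons E.
Qed.

Definition tell_all i bs t : ctree := foldr (CTell i) t bs.

Fixpoint ask_all i n (k : seq bool -> ctree) acc : ctree :=
  if n is n'.+1 then CAsk i (fun b => ask_all i n' k (rcons acc b)) else k acc.

Lemma ceval_tell_all i bs t h :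
  ceval (tell_all i bs t) h =
  let e := ceval t (h ++ [seq (i, (to_server, b)) | b <- bs]) in
  (e.1, (size bs + e.2)%N).
Proof.
elim: bs h => [|b bs IH] h /=; first by rewrite cats0; case: ceval.
by rewrite IH cat_rcons /= addSn.
Qed.

Lemma ceval_ask_all i bs k acc h :
  (forall bs1 b bs2, bs = bs1 ++ b :: bs2 ->
    reply i (x i) (channel i h ++ [seq (to_coordinator, b') | b' <- bs1]) = b) ->
  ceval (ask_all i (size bs) k acc) h =
  let e := ceval (k (acc ++ bs)) (h ++ [seq (i, (to_coordinator, b)) | b <- bs]) in
  (e.1, (size bs + e.2)%N).
Proof.
elim: bs acc h => [|b bs IH] acc h H /=; first by rewrite !cats0; case: ceval.
have := H [::] b bs erefl; rewrite cats0 => ->.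
rewrite IH ?cat_rcons //= => bs1 b1 bs2 E.
by rewrite channel_rcons cat_rcons; apply: (H (b :: bs1) _ bs2); rewrite E.
Qed.

End CoordTrees.

Section BoardTrees.
Variables (s : nat) (X0 X O : Type).

(** Everybody reads the board and hence knows the current node, so the function by which the speaker
    computes its bit can be stored there. *)
Inductive btree :=
  | BOut of O
  | BSay of 'I_s & (X -> bool) & (bool -> btree).

Definition bstep (t : btree) (b : bool) : btree :=
  match t with
  | BOut o => BOut o
  | BSay _ _ k => k b
  end.

Definition board_of_tree (t : btree) (o : O) : board_protocol s X0 X O :=
  BoardProtocol
    (fun h => if foldl bstep t h is BSay i _ _ then Some (Server i) else None)
    (fun _ _ => false)
    (fun i x h => if foldl bstep t h is BSay _ f _ then f x else false)
    (fun _ h => if foldl bstep t h is BOut o' then o' else o).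

Variable (x : 'I_s -> X).

Fixpoint beval (t : btree) : O * nat :=
  match t with
  | BOut o => (o, 0%N)
  | BSay i f k => let e := beval (k (f (x i))) in (e.1, e.2.+1)
  end.

Lemma run_board_of_tree t o x0 c : ((beval t).2 <= c)%N ->
  board_run_from (board_of_tree t o) x0 x c [::] = Some (beval t).1.
Proof.
have: foldl bstep t [::] = t by [].
elim: {2 3 5}t [::] c => [out'|i f k IH] h c /= E.
- by case: c => [|c] _ /=; rewrite E.
- case: c => // c h1; rewrite /= E; apply: IH => //.
  by rewrite foldl_rcons E.
Qed.

Fixpoint say_all i n (f : X -> seq bool) (k : seq bool -> btree) acc : btree :=
  if n is n'.+1 then BSay i (fun y => nth false (f y) (size acc))
    (fun b => say_all i n' f k (rcons acc b)) else k acc.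

Lemma beval_say_all i n f k : size (f (x i)) = n ->
  beval (say_all i n f k [::]) =
  let e := beval (k (f (x i))) in (e.1, (n + e.2)%N).
Proof.
move=> sn; suff H acc bs : f (x i) = acc ++ bs -> beval (say_all i (size bs) f k acc) =
    let e := beval (k (f (x i))) in (e.1, (size bs + e.2)%N).
  by rewrite -{1 2}sn; apply: H.
elim: bs acc => [|b bs IH] acc E /=; first by rewrite E cats0; case: beval.
have -> : nth false (f (x i)) (size acc) = b by rewrite E nth_cat ltnn subnn.
by rewrite IH ?cat_rcons //= addSn.
Qed.

End BoardTrees.

(** * Deterministic protocols *)

Section DeterministicProtocols.
Variables (R : realType) (s d L : nat).
Local Notation w := (d + 1)%N.
Local Notation row_bits := (w * (L + 2))%N.
Implicit Types (rs V X : seq 'rV[int]_w).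

Definition enc_rows rs := flatten [seq enc_row L r | r <- rs].

Definition dec_rows n bs := [seq dec_row w L c | c <- reshape (nseq n row_bits) bs].

Lemma size_enc_rows rs : size (enc_rows rs) = (size rs * row_bits)%N.
Proof.
by elim: rs => //= r rs IH; rewrite /enc_rows /= size_cat size_enc_row -/(enc_rows rs) IH mulSn.
Qed.

Lemma enc_rowsK rs : (forall r, r \in rs -> bounded_row L r) ->
  dec_rows (size rs) (enc_rows rs) = rs.
Proof.
move=> brs; rewrite /dec_rows /enc_rows.
have -> : nseq (size rs) row_bits = shape [seq enc_row L r | r <- rs].
  by elim: rs {brs} => //= r rs ->; rewrite size_enc_row.
rewrite flattenK -map_comp -[RHS]map_id; apply/eq_in_map => r /brs.
exact: enc_rowK.
Qed.

Lemma bounded_row0 : bounded_row L (0 : 'rV[int]_w).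
Proof. by move=> j; rewrite mxE normr0 exprn_ge0. Qed.

(** Padding fixes the length of the message, so the coordinator knows how many bits to ask for. *)
Definition padded_basis X :=
  let g := greedy R [::] X in g ++ nseq (w - size g) 0.

Lemma size_padded_basis X : size (padded_basis X) = w.
Proof.
rewrite size_cat size_nseq subnKC // (@indep_size _ R) //.
by apply: greedy_indep; rewrite /indep eqn_leq rank_leq_row leq0n.
Qed.

Lemma mem_padded_basis X r : r \in padded_basis X -> r = 0 \/ r \in X.
Proof.
rewrite mem_cat => /orP[/greedy_mem[//|]|]; first by right.
by rewrite mem_nseq => /andP[_ /eqP ->]; left.
Qed.

Fixpoint collect_bases (l : seq 'I_s) rs : ctree s (option 'cV[R]_d) :=
  if l is i :: l' then
    ask_all i (w * row_bits)
      (fun bs => collect_bases l' (rs ++ dec_rows w bs)) [::]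
  else COut s (solve R rs).

(** The coordinator sends nothing, so the channel holds only the server's own earlier bits, and
    their number is the position of the next one. *)
Definition send_basis (i : 'I_s) X (ch : seq (direction * bool)) :=
  nth false (enc_rows (padded_basis X)) (size ch).

Lemma ceval_collect_bases (x : 'I_s -> seq 'rV[int]_w) l rs h :
  (forall i r, r \in x i -> bounded_row L r) ->
  uniq l -> (forall i, i \in l -> channel i h = [::]) ->
  ceval send_basis x (collect_bases l rs) h =
  (solve R (rs ++ flatten [seq padded_basis (x i) | i <- l]),
   (size l * (w * row_bits))%N).
Proof.
move=> bx; elim: l rs h => [|i l IH] rs h; first by rewrite /= cats0.
rewrite cons_uniq => /andP[il ul] hl; rewrite [collect_bases _ _]/=.
have szE : (w * row_bits)%N = size (enc_rows (padded_basis (x i))).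
  by rewrite size_enc_rows size_padded_basis.
rewrite {1}szE ceval_ask_all => [|bs1 b bs2 E]; last first.
  rewrite hl ?mem_head //= /send_basis size_map E.
  by rewrite nth_cat ltnn subnn.
have decE : dec_rows w (enc_rows (padded_basis (x i))) = padded_basis (x i).
  rewrite -{2}(enc_rowsK (rs := padded_basis (x i))) ?size_padded_basis //.
  by move=> r /mem_padded_basis[->|/bx //]; apply: bounded_row0.
rewrite -szE cat0s decE.
rewrite IH //= ?catA // => j jl; rewrite channel_cat hl ?inE ?jl ?orbT //.
by rewrite (map_comp (fun m => (i, m)) (pair to_coordinator)) channel_other //;
  apply: contraNneq il => ->.
Qed.

Lemma deterministic_coordinator_protocol n :
  deterministically_solvable R coordinator_model s n d L (s * (w * row_bits)).
Proof.
exists (coord_of_tree (fun _ => collect_bases (enum 'I_s) [::]) send_basis).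
move=> I bI; pose x := held I.
have e := ceval_collect_bases (x := x) [::] (h := [::]) (fun i r => bounded_held bI)
  (enum_uniq 'I_s) (fun i _ => erefl).
exists (solve R (flatten [seq padded_basis (x i) | i <- enum 'I_s])).
  rewrite /run run_coord_of_tree e //=.
  by rewrite size_enum_ord.
apply: correct_solve => [r|j].
  case/flatten_mapP => i _ /mem_padded_basis[->|/mem_held]; [by left|by right].
apply: (inspan_trans (rs' := padded_basis (x (holder I j)))).
  apply/allP => r rX; apply: inspan_mem; apply/flatten_mapP.
  by exists (holder I j) => //; rewrite mem_enum.
apply: (inspan_trans (rs' := greedy R [::] (x (holder I j)))).
  by apply/allP => r rX; apply: inspan_mem; rewrite mem_cat rX.
exact/greedy_inspanr/inrow_held.
Qed.

Fixpoint board_phase (i : 'I_s) (fuel : nat) V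
    (k : seq 'rV[int]_w -> btree s (seq 'rV[int]_w) (option 'cV[R]_d)) :=
  if fuel is fuel'.+1 then
    BSay i (fun X => fresh R V X != [::]) (fun b =>
      if b then
        say_all i row_bits (fun X => enc_row L (head 0 (fresh R V X)))
          (fun bs => board_phase i fuel' (dec_row w L bs :: V) k) [::]
      else k V)
  else k V.

(** Each positive flag is followed by a row that enlarges the basis, and the phase ends with one
    negative flag. An independent list has at most [w] rows, so under [w < size V + fuel] the fuel
    outlasts the rows. *)
Lemma beval_board_phase (x : 'I_s -> seq 'rV[int]_w) i fuel V k :
  (forall r, r \in x i -> bounded_row L r) ->
  indep R V -> (w < size V + fuel)%N ->
  let V' := greedy R V (x i) in
  beval x (board_phase i fuel V k) =
  ((beval x (k V')).1,
   ((size V' - size V) * row_bits.+1 + 1 + (beval x (k V')).2)%N).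
Proof.
move=> bx; elim: fuel V => [|fuel IH] V iV.
  by rewrite addn0 ltnNge (indep_size iV).
move=> wV /=; case E: (fresh R V (x i)) => [|r Y] /=.
  by rewrite (greedy_fresh0 E) subnn mul0n.
have [rX rV] := fresh_head E.
rewrite beval_say_all E ?size_enc_row //= enc_rowK; last exact: bx.
rewrite IH; [|exact: indep_cons|by rewrite /= addSnnS].
rewrite -(greedy_fresh E) /=; congr (_, _).
have := greedy_size R (r :: V) (x i); rewrite -(greedy_fresh E) /=.
move: (size _) (size _) (_ * (L + 2))%N => a b c h; rewrite -[(a - b)%N](@subnK 1); last lia.
by rewrite mulnDl subn1 subnS; lia.
Qed.

Fixpoint board_phases (l : seq 'I_s) V : btree s (seq 'rV[int]_w) (option 'cV[R]_d) :=
  if l is i :: l' then board_phase i w.+1 V (board_phases l')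
  else BOut s (seq 'rV[int]_w) (solve R V).

Lemma beval_board_phases (x : 'I_s -> seq 'rV[int]_w) l V :
  (forall i r, r \in x i -> bounded_row L r) -> indep R V ->
  let V' := foldl (@greedy R _) V [seq x i | i <- l] in
  [/\ indep R V', (size V <= size V')%N & beval x (board_phases l V) =
    (solve R V', ((size V' - size V) * row_bits.+1 + size l)%N)].
Proof.
move=> bx; elim: l V => [|i l IH] V iV; first by rewrite /= subnn mul0n.
rewrite [map _ _]/= [foldl _ _ _]/=.
have [iV' leV e] := IH _ (greedy_indep (x i) iV).
have leV2 := greedy_size R V (x i).
split=> //; first exact: leq_trans leV.
change (board_phases (i :: l) V) with (board_phase i w.+1 V (board_phases l)).
rewrite beval_board_phase ?e //; [rewrite /=; congr (_, _)|exact: bx|lia].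
rewrite addnAC addnA -mulnDl.
have -> : forall a b c, (a <= b)%N -> (b <= c)%N -> (b - a + (c - b) = c - a)%N by lia.
all: lia.
Qed.

Lemma deterministic_board_protocol n :
  deterministically_solvable R blackboard_model s n d L (w * row_bits.+1 + s).
Proof.
exists (board_of_tree unit (board_phases (enum 'I_s) [::]) None).
move=> I bI; pose x := held I.
have i0 : indep R ([::] : seq 'rV[int]_w).
  by rewrite /indep eqn_leq rank_leq_row leq0n.
have [iV _ e] := beval_board_phases (enum 'I_s) (x := x) (fun i r => bounded_held bI) i0.
set V := foldl _ _ _ in iV e.
exists (solve R V).
  rewrite /run run_board_of_tree e //= subn0 size_enum_ord leq_add2r leq_mul2r.
  by rewrite (indep_size iV) orbT.
have memV l U : (forall r, r \in U -> exists j, r = inrow I j) ->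
    forall r, r \in foldl (@greedy R _) U [seq x i | i <- l] -> exists j, r = inrow I j.
  elim: l U => //= i l IH U UI; apply: IH => r /greedy_mem[/UI //|]; exact: mem_held.
have spanl l U r : inspan R U r -> inspan R (foldl (@greedy R _) U [seq x i | i <- l]) r.
  by elim: l U => //= i l IH U h; apply/IH/greedy_inspanl.
have spanr l U i r : i \in l -> r \in x i ->
    inspan R (foldl (@greedy R _) U [seq x i | i <- l]) r.
  elim: l U => //= i' l IH U; rewrite inE => /orP[/eqP <-|il] rx; last exact: IH.
  exact/spanl/greedy_inspanr.
apply: correct_solve => [r rV|j].
  by right; apply: memV rV.
by apply: (spanr _ _ (holder I j)); [rewrite mem_enum|apply: inrow_held].
Qed.

End DeterministicProtocols.

(** * The randomized coordinator protocol *)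

Section Hashing.
Variables (w K : nat).
Implicit Types (r : 'rV[int]_w) (V X : seq 'rV[int]_w) (u : {ffun 'I_w -> 'I_K}).

Definition detects (F : fieldType) (g : 'cV[F]_w) r : bool := map_mx intr r *m g != 0.

(* The columns of the cokernel span the orthogonal of [V]. *)
Definition hash_vec (F : fieldType) V u : 'cV[F]_w :=
  cokermx (map_mx intr (rows_mx V)) *m \col_j (u j)%:R.

Lemma hash_sound (F : fieldType) V u r :
  detects (hash_vec F V u) r -> ~~ inspan F V r.
Proof.
apply: contraNN; rewrite /inspan submxE => /eqP e.
by rewrite /hash_vec mulmxA e mul0mx.
Qed.

(** Off the span, [r] times the cokernel is a nonzero vector [c]. Once the coordinates of [u] other
    than a [j] with [c_j != 0] are fixed, at most one value of [u_j] kills the product; [K <= p]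
    keeps the [K] values distinct modulo [p]. *)
Lemma card_missed (p : nat) V r : prime p -> (K <= p)%N -> ~~ inspan 'F_p V r ->
  (#|[pred u | ~~ detects (hash_vec 'F_p V u) r]| * K <= K ^ w)%N.
Proof.
move=> pp Kp; rewrite /inspan submxE.
set c := _ *m cokermx _ => c0.
have [j cj] : exists j, c 0 j != 0.
  by case: (rV0Pn _ c0) => j cj; exists j.
have detE u : ~~ detects (hash_vec 'F_p V u) r = (\sum_k c 0 k * (u k)%:R == 0).
  rewrite /detects /hash_vec mulmxA -/c negbK; apply/eqP/eqP => [/matrixP/(_ 0 0)|e].
    rewrite [LHS]mxE [RHS]mxE => e; rewrite -[RHS]e.
    by apply: eq_bigr => k _; congr (_ * _); rewrite mxE.
  apply/matrixP => a b; rewrite !ord1 [LHS]mxE [RHS]mxE -[RHS]e.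
  by apply: eq_bigr => k _; congr (_ * _); rewrite mxE.
have splitE v : \sum_k c 0 k * (v k : 'I_K)%:R = c 0 j * (v j)%:R +
    \sum_(k | k != j) c 0 k * (v k)%:R by rewrite (bigD1 j).
clearbody c.
pose A := [pred u | ~~ detects (hash_vec 'F_p V u) r].
(* Overwriting coordinate [j] loses nothing: for a missed [u] it is determined by the others. This
   injects [A * 'I_K] into all the vectors. *)
pose f (ut : {ffun 'I_w -> 'I_K} * 'I_K) : {ffun 'I_w -> 'I_K} :=
  [ffun k => if k == j then ut.2 else ut.1 k].
have finj : {in [predX A & 'I_K] &, injective f}.
  move=> [u t] [u' t'] /andP[uA _] /andP[uA' _] /ffunP e.
  have eu : \sum_k c 0 k * (u k)%:R = 0 by apply/eqP; rewrite -detE; exact: uA.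
  have eu' : \sum_k c 0 k * (u' k)%:R = 0 by apply/eqP; rewrite -detE; exact: uA'.
  have tt' : t = t' by have := e j; rewrite !ffunE eqxx.
  have off k : k != j -> u k = u' k by move=> kj; have := e k; rewrite !ffunE (negbTE kj).
  have uj : u j = u' j.
    have : c 0 j * (u j)%:R = c 0 j * (u' j)%:R.
      move: eu eu'; rewrite !splitE.
      have -> : \sum_(k | k != j) c 0 k * (u k)%:R = \sum_(k | k != j) c 0 k * (u' k)%:R.
        by apply: eq_bigr => k kj; rewrite off.
      by move=> eu eu'; apply: (addIr (\sum_(k | k != j) c 0 k * (u' k)%:R)); rewrite eu.
    move/(mulfI cj) => /(congr1 (fun z : 'F_p => z : nat)).
    rewrite !val_Fp_nat // !modn_small => [/val_inj //||];
    exact: leq_trans (ltn_ord _) Kp.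
  by rewrite tt'; congr (_, _); apply/ffunP => k; case: (eqVneq k j) => [->|/off].
have := card_in_image finj; rewrite cardX card_ord => <-.
apply: leq_trans (max_card _) _.
by rewrite card_ffun !card_ord.
Qed.

Section Good.
Variables (F : fieldType) (u : {ffun 'I_w -> 'I_K}).

(** Only the tests made along the greedy run are required to succeed. The lists [V] met there do not
    depend on [u], so one [u] can serve every round. *)
Fixpoint good V X : bool :=
  if X is r :: X' then
    if inspan F V r then good V X'
    else detects (hash_vec F V u) r && good (r :: V) X'
  else true.

Lemma good_cat V X X' : good V (X ++ X') = good V X && good (greedy F V X) X'.
Proof. by elim: X V => //= r X IH V; case: ifP => _; rewrite IH ?andbA. Qed.

Lemma good_fresh V X r Y : good V X -> fresh F V X = r :: Y ->
  detects (hash_vec F V u) r && good (r :: V) X.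
Proof.
elim: X V => //= a X IH V; rewrite /fresh /=; case: ifPn => aV /=.
  by rewrite (inspan_behead r aV); apply: IH.
by move=> /andP[dt gd] [<- _]; rewrite inspan_head dt.
Qed.

(** By soundness no row before the first fresh one is detected, and [good] has that fresh row
    detected. *)
Lemma fresh_detected V X : good V X ->
  ohead [seq r <- X | detects (hash_vec F V u) r] = ohead (fresh F V X).
Proof.
elim: X => [|r X IH] /=; first by [].
rewrite /fresh /=; case: ifPn => rV /=; last first.
  by move=> /andP[-> _].
by rewrite ifN; [apply: IH | apply: contraL rV => /hash_sound].
Qed.

End Good.

(** Union bound: each test enlarges an independent list, so at most [w - size V] of them occur, and
    each fails for a fraction of at most [1 / K] of the vectors. *)
Lemma card_not_good p V X : prime p -> (K <= p)%N -> indep 'F_p V ->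
  (#|[pred u | ~~ good 'F_p u V X]| * K <= (w - size V) * K ^ w)%N.
Proof.
move=> pp Kp; elim: X V => [|r X IH] V iV /=.
  by rewrite eq_card0 // => u; rewrite inE.
have [rV|rV] := boolP (inspan _ V r); first exact: IH.
have iV' := indep_cons iV rV.
have := leq_add (card_missed pp Kp rV) (IH _ iV').
rewrite -mulnDl -mulSn -subSn ?(indep_size iV') // subSS; apply: leq_trans.
rewrite leq_mul2r; apply/orP; right.
set A := [pred u | ~~ detects _ _]; set B := [pred u | ~~ good _ _ _ _].
have := leq_addr #|predI A B| #|predU A B|; rewrite cardUI; apply: leq_trans.
apply/subset_leq_card/fintype.subsetP => u; rewrite !inE negb_and.
exact.
Qed.

End Hashing.

Section HashProtocol.
Variables (R : realType) (s d L b K : nat).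
Local Notation w := (d + 1)%N.
Local Notation row_bits := (w * (L + 2))%N.
Local Notation query_bits := (w.+1 * b)%N.
Local Notation round := (query_bits.+1 + row_bits)%N.
Implicit Types (V X : seq 'rV[int]_w).

(** The prime travels with the vector, because a server does not see the coordinator's coins. *)
Definition enc_query p (g : 'cV['F_p]_w) : seq bool :=
  enc_nats b (p :: [seq (g j 0 : nat) | j <- enum 'I_w]).

Definition query_found (bs : seq bool) X :=
  let xs := dec_nats b w.+1 bs in
  [seq r <- X | detects (\col_(j < w) (nth 0%N (behead xs) j)%:R : 'cV['F_(head 0%N xs)]_w) r].

Lemma size_enc_query p (g : 'cV['F_p]_w) : size (enc_query g) = query_bits.
Proof. by rewrite /enc_query size_enc_nats /= size_map size_enum_ord. Qed.

Lemma enc_queryK p (g : 'cV['F_p]_w) X : prime p -> (p < 2 ^ b)%N ->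
  query_found (enc_query g) X = [seq r <- X | detects g r].
Proof.
move=> pp pb; rewrite /query_found /enc_query.
set xs := p :: _.
have xsw : size xs = w.+1 by rewrite /= size_map size_enum_ord.
have -> : dec_nats b w.+1 (enc_nats b xs) = xs.
  rewrite -{1}xsw enc_natsK // /xs /= pb; apply/allP => _ /mapP[j _ ->].
  by apply: leq_trans pb; rewrite ltnW // ltnS -[X in (_ < X)%N](Fp_cast pp) ltn_ord.
apply: eq_filter => r; congr (detects _ r).
apply/colP => j; rewrite mxE (nth_map j) ?size_enum_ord // nth_ord_enum.
exact: natr_Zp.
Qed.

(** A round consists of a query, a flag and a row, and the channel length modulo [round] tells the
    server where it stands. A round cut short by a negative flag is the last one on its channel, so
    alignment is never lost. *)
Definition hash_reply (i : 'I_s) X (ch : seq (direction * bool)) : bool :=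
  let pos := (size ch %% round)%N in
  let found := query_found
    [seq m.2 | m <- take query_bits (drop (size ch - pos) ch)] X in
  if pos == query_bits then found != [::]
  else nth false (enc_row L (head 0 found)) (pos - query_bits.+1).

Variables (p : nat) (u : {ffun 'I_w -> 'I_K}).
Hypotheses (pp : prime p) (pb : (p < 2 ^ b)%N).
Local Notation query V := (enc_query (hash_vec 'F_p V u)).

Lemma hash_reply_at i X V ch rest :
  (round %| size ch)%N -> (size rest <= row_bits)%N ->
  hash_reply i X (ch ++ [seq (to_server, a) | a <- query V] ++ rest) =
  let found := [seq r <- X | detects (hash_vec 'F_p V u) r] in
  if rest is _ :: rest' then nth false (enc_row L (head 0 found)) (size rest')
  else found != [::].
Proof.
move=> rch srest; rewrite /hash_reply !size_cat size_map size_enc_query.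
have -> : ((size ch + (query_bits + size rest)) %% round = query_bits + size rest)%N.
  by rewrite -modnDml (eqP rch) add0n modn_small // addSn ltnS leq_add2l.
rewrite addnK drop_size_cat // take_cat size_map size_enc_query ltnn subnn take0 cats0.
rewrite -map_comp map_id enc_queryK //.
case: rest srest => [|m rest] _ /=; first by rewrite addn0 eqxx.
rewrite ifN; last by rewrite -[X in _ == X]addn0 eqn_add2l.
by congr nth; rewrite addnS subSS addKn.
Qed.

Fixpoint hash_phase (i : 'I_s) (fuel : nat) V
    (k : seq 'rV[int]_w -> ctree s (option 'cV[R]_d)) :=
  if fuel is fuel'.+1 then
    tell_all i (query V) (CAsk i (fun b =>
      if b then
        ask_all i row_bits (fun bs => hash_phase i fuel' (dec_row w L bs :: V) k) [::]
      else k V))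
  else k V.

(** If a test fails, [V'] is some other list, but by soundness it is still independent. This bounds
    the cost for all coins, as a worst-case cost requires. *)
Lemma ceval_hash_phase (x : 'I_s -> seq 'rV[int]_w) i fuel V k h :
  (forall r, r \in x i -> bounded_row L r) ->
  indep 'F_p V -> (w < size V + fuel)%N -> (round %| size (channel i h))%N ->
  exists V' h', [/\ indep 'F_p V' /\ (size V <= size V')%N,
    (forall j, j != i -> channel j h' = channel j h),
    good 'F_p u V (x i) -> V' = greedy 'F_p V (x i) &
    ceval hash_reply x (hash_phase i fuel V k) h =
    ((ceval hash_reply x (k V') h').1,
     ((size V' - size V) * round + query_bits.+1 +
      (ceval hash_reply x (k V') h').2)%N)].
Proof.
move=> bx; elim: fuel V h => [|fuel IH] V h iV.
  by rewrite addn0 ltnNge (indep_size iV).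
move=> wV rh; rewrite /= ceval_tell_all /= size_enc_query.
set h1 := h ++ _.
have h1E : channel i h1 = channel i h ++ [seq (to_server, a) | a <- query V].
  by rewrite channel_cat (map_comp (pair i) (pair to_server)) channel_own.
have h1j j : j != i -> channel j h1 = channel j h.
  move=> ji; rewrite channel_cat (map_comp (pair i) (pair to_server)).
  by rewrite channel_other ?cats0 // eq_sym.
have := @hash_reply_at i (x i) V (channel i h) [::] rh (leq0n _).
rewrite /= cats0 -h1E => ->.
set found := [seq r <- x i | detects (hash_vec 'F_p V u) r].
set h2 := rcons h1 (i, (to_coordinator, found != [::])).
have h2E : channel i h2 = channel i h ++ [seq (to_server, a) | a <- query V] ++
    [:: (to_coordinator, found != [::])].
  by rewrite channel_rcons h1E -cats1 catA.
have h2j j : j != i -> channel j h2 = channel j h.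
  move=> ji; rewrite /h2 -cats1 channel_cat h1j //.
  by rewrite (@channel_other _ i j [:: _]) ?cats0 // eq_sym.
case: ifP => [fn0|/negbFE/eqP f0]; last first.
  exists V, h2; split=> //.
    move=> g; have := fresh_detected g; rewrite -/found f0 /=.
    by case Ef: (fresh _ _ _) => // _; rewrite (greedy_fresh0 Ef).
  by rewrite subnn mul0n add0n /=; congr (_, _); lia.
have [r [Y E]] : exists r Y, found = r :: Y.
  by case: found fn0 {h2 h2E h2j} => // r Y _; exists r, Y.
have /andP[rdet rx] : detects (hash_vec 'F_p V u) r && (r \in x i).
  by rewrite -mem_filter -/found E mem_head.
have rV := hash_sound rdet.
rewrite -(size_enc_row L r) ceval_ask_all => [|bs1 b0 bs2 Eb]; last first.
  rewrite h2E -!catA cat1s hash_reply_at //; last first.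
    by rewrite /= size_map -(size_enc_row L r) Eb size_cat /=; lia.
  by rewrite /= -/found E size_map /= Eb nth_cat ltnn subnn.
rewrite cat0s enc_rowK; last exact: bx.
set h3 := h2 ++ _.
have h3E : channel i h3 = channel i h2 ++ [seq (to_coordinator, a) | a <- enc_row L r].
  by rewrite channel_cat (map_comp (pair i) (pair to_coordinator)) channel_own.
have h3j j : j != i -> channel j h3 = channel j h.
  move=> ji; rewrite channel_cat (map_comp (pair i) (pair to_coordinator)) h2j //.
  by rewrite channel_other ?cats0 // eq_sym.
have rh3 : (round %| size (channel i h3))%N.
  rewrite h3E h2E !size_cat !size_map size_enc_query size_enc_row /=.
  have -> a c e : (a + (c + 1) + e = a + (c.+1 + e))%N by lia.
  by rewrite dvdn_addr ?dvdnn //; move: rh; rewrite size_map.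
have [||V' [h' [[iV' sV'] hj gV' e]]] := IH (r :: V) h3 _ _ rh3.
- exact: indep_cons.
- by rewrite /= addSnnS.
exists V', h'; split.
- by split=> //; apply: ltnW.
- by move=> j ji; rewrite hj // h3j.
- move=> g; have fE : fresh 'F_p V (x i) = r :: behead (fresh 'F_p V (x i)).
    have := fresh_detected g; rewrite -/found E /=.
    by case: (fresh _ _ _) => //= r' Z [->].
  have /andP[_ g'] := good_fresh g fE.
  by rewrite (gV' g') -(greedy_fresh fE).
rewrite /= e /= size_enc_row; congr (_, _).
move: sV' => /=; move: (size V') (size V) (_ * (L + 2))%N (_ * b)%N => m1 m2 m3 m4 h5.
rewrite -[(m1 - m2)%N](@subnK 1); last lia.
by rewrite mulnDl subn1 subnS; lia.
Qed.

Fixpoint hash_phases (l : seq 'I_s) V : ctree s (option 'cV[R]_d) :=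
  if l is i :: l' then hash_phase i w.+1 V (hash_phases l')
  else COut s (solve R V).

Lemma ceval_hash_phases (x : 'I_s -> seq 'rV[int]_w) l V h :
  (forall i r, r \in x i -> bounded_row L r) -> indep 'F_p V ->
  uniq l -> (forall i, i \in l -> channel i h = [::]) ->
  exists V', [/\ indep 'F_p V', (size V <= size V')%N,
    good 'F_p u V (flatten [seq x i | i <- l]) ->
      V' = greedy 'F_p V (flatten [seq x i | i <- l]) &
    ceval hash_reply x (hash_phases l V) h =
    (solve R V', ((size V' - size V) * round + size l * query_bits.+1)%N)].
Proof.
move=> bx; elim: l V h => [|i l IH] V h iV.
  by move=> _ _; exists V; rewrite /= subnn mul0n.
rewrite cons_uniq => /andP[il ul] hl.
have ri : (round %| size (channel i h))%N by rewrite hl ?mem_head ?dvdn0.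
have wV : (w < size V + w.+1)%N by lia.
have [V1 [h1 [[iV1 sV1] hj gV1 e1]]] :=
  ceval_hash_phase (hash_phases l) (fun r => bx i r) iV wV ri.
have [j jl|V' [iV' sV' gV' e']] := IH V1 h1 iV1 ul.
  rewrite hj ?hl ?inE ?jl ?orbT //.
  by apply: contraNneq il => <-.
exists V'; split=> //; first exact: leq_trans sV'.
  rewrite [map _ _]/= [flatten _]/= good_cat greedy_cat => /andP[g1 g2].
  by rewrite gV' (gV1 g1).
change (hash_phases (i :: l) V) with (hash_phase i w.+1 V (hash_phases l)).
rewrite e1 e' /=; congr (_, _).
rewrite addnACA -mulnDl mulSn.
by congr (_ * _ + _)%N; lia.
Qed.

End HashProtocol.

Lemma leq_fact_exp2 w : (w`! <= 2 ^ (w * w))%N.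
Proof.
elim: w => // w IH; rewrite factS.
have h : (w.+1 * w`! <= 2 ^ w.+1 * 2 ^ (w * w))%N.
  by apply: leq_mul => //; apply/ltnW/ltn_expl.
by apply: leq_trans h _; rewrite -expnD leq_exp2l //; lia.
Qed.

Lemma primes_dvd_leq (ps : seq nat) D : (0 < D)%N -> uniq ps -> all prime ps ->
  all (fun p => p %| D)%N ps -> (2 ^ size ps <= D)%N.
Proof.
move=> D0 ups /allP pps /allP dps.
apply: (@leq_trans (2 ^ size (primes D))).
  rewrite leq_exp2l //; apply: uniq_leq_size => // p pin.
  by rewrite mem_primes D0 pps // dps.
rewrite [X in (_ <= X)%N](prod_prime_decomp D0) prime_decompE big_map /=.
rewrite -sum1_size expn_sum big_seq [X in (_ <= X)%N]big_seq.
apply: leq_prod => p; rewrite expn1 => pD.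
have pp : prime p by move: pD; rewrite mem_primes => /andP[].
apply: leq_trans (prime_gt1 pp) _; rewrite -[X in (X <= _)%N]expn1.
by apply: leq_pexp2l; [exact: prime_gt0|rewrite logn_gt0].
Qed.

Lemma rows_mx_bounded w L (rs : seq 'rV[int]_w) i j :
  (forall r, r \in rs -> bounded_row L r) -> (`|rows_mx rs i j|%N <= 2 ^ L)%N.
Proof.
elim: rs i => [|r rs IH] i brs; first by rewrite mxE.
have [k ->|k ->] := split_ordP (i : 'I_(1 + size rs)).
  rewrite (col_mxEu r (rows_mx rs)) ord1.
  by have := brs r (mem_head _ _) j; rewrite powZE; lia.
rewrite (col_mxEd r (rows_mx rs)); apply: IH => r' r'rs.
by apply: brs; rewrite inE r'rs orbT.
Qed.

Lemma proba_fst (R : realType) (A T : finType) (G : pred A) (E : A * T -> Prop) :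
  (0 < #|A|)%N -> (0 < #|T|)%N -> (forall x, G x.1 -> E x) ->
  (100 * #|[pred a | ~~ G a]| <= #|A|)%N -> 99%:R / 100%:R <= proba R E.
Proof.
move=> A0 T0 GE cG; rewrite /proba.
have cE : (#|G| * #|T| <= #|[pred x : A * T | `[< E x >]]|)%N.
  rewrite -cardX; apply/subset_leq_card/fintype.subsetP => x.
  rewrite !unfold_in => /andP[Gx _]; apply/asboolP/GE; exact: Gx.
have cA : (#|G| + #|[pred a | ~~ G a]| = #|A|)%N.
  by rewrite -(cardC G); congr (_ + _)%N; apply: eq_card => a.
have h : (99 * (#|A| * #|T|) <= 100 * #|[pred x : A * T | `[< E x >]]|)%N.
  apply: leq_trans (leq_mul (leqnn 100) cE); rewrite !mulnA leq_mul2r; lia.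
rewrite card_prod ler_pdivrMr ?ltr0n // mulrAC ler_pdivlMr ?ltr0n ?muln_gt0 ?A0 //.
by rewrite -!natrM ler_nat [X in (_ <= X)%N]mulnC.
Qed.

Section RandomizedProtocol.
Variables (R : realType) (s n d L : nat).
Local Notation w := (d + 1)%N.

(* The ranks satisfy rank_R X <= rank_p X <= rank_p V <= rank_R V <= rank_R X. *)
Lemma span_lift (p D : nat) (X V : seq 'rV[int]_w) :
  prime p -> ~~ (p %| D)%N ->
  (forall p, prime p -> ~~ (p %| D)%N ->
      (\rank (map_mx intr (rows_mx X) : 'M[R]_(_, _)) <=
       \rank (map_mx intr (rows_mx X) : 'M['F_p]_(_, _)))%N) ->
  indep 'F_p V -> {subset V <= X} -> all (inspan 'F_p V) X ->
  all (inspan R V) X.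
Proof.
move=> pp pD rkX iV VX; rewrite -!rows_mx_sub => XV.
have VXR : (map_mx intr (rows_mx V) <= (map_mx intr (rows_mx X) : 'M[R]_(_, _)))%MS.
  by rewrite rows_mx_sub; apply/allP => r /VX; apply: inspan_mem.
rewrite -(mxrank_leqif_sup VXR) eqn_leq mxrankS //=.
apply: leq_trans (rkX p pp pD) _; apply: leq_trans (mxrankS XV) _.
apply: rank_transfer => z; apply: contraNneq => /eqP.
by rewrite intr_eq0 => /eqP ->.
Qed.

(** The error is 1/200 + 1/200. At most [K = 200 w] of the [2 ^ q] primes lie below [K], which
    leaves at least [200 w (w + L)]; at most [w (w + L)] primes divide the minor [D], since
    [D <= w! * 2 ^ (L w) <= 2 ^ (w (w + L))]. For any other prime some test fails with probability
    at most [w / K]. Each collected row costs [Q] plus the row, and each server one last [Q] for a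
    negative answer. *)
Lemma randomized_coordinator_protocol q : (2 < q)%N ->
  (200 * w * (w + L + 1) <= 2 ^ q)%N ->
  let Q := (w.+1 * q.*2.+2).+1 in
  randomly_solvable R private_coins coordinator_model s n d L
    (w * (Q + w * (L + 2)) + s * Q).
Proof.
move=> q2 hq Q; set c := (_ + _)%N.
have [ps0 [ups0 pps0 ps0le ps0size]] := many_primes q2.
pose K := (200 * w)%N; pose ps := [seq p <- ps0 | (K <= p)%N].
pose N := size ps; pose b := q.*2.+2.
have N_ge : (200 * (w * (w + L)) <= N)%N.
  have : (size [seq p <- ps0 | (p < K)%N] <= K)%N.
    rewrite -[X in (_ <= X)%N](size_iota 0); apply: uniq_leq_size.
      exact: filter_uniq.
    by move=> p; rewrite mem_filter mem_iota => /andP[].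
  have := count_predC (fun p => K <= p)%N ps0; rewrite /N /ps !size_filter.
  have -> : count (predC (fun p => K <= p)%N) ps0 = count (fun p => p < K)%N ps0.
    by apply: eq_count => p /=; rewrite ltnNge.
  rewrite /K; lia.
have N0 : (0 < N)%N by apply: leq_trans N_ge; lia.
pose pr (k : 'I_N) := nth 0%N ps k.
have prE k : pr k \in ps by apply: mem_nth.
have pr_prime k : prime (pr k).
  by have := prE k; rewrite mem_filter => /andP[_ /(allP pps0)].
have pr_lt k : (pr k < 2 ^ b)%N.
  have := prE k; rewrite mem_filter => /andP[_ /(allP ps0le)] h.
  by apply: leq_ltn_trans h _; rewrite ltn_exp2l.
have pr_ge k : (K <= pr k)%N by have := prE k; rewrite mem_filter => /andP[].
pose W := ('I_N * {ffun 'I_w -> 'I_K})%type.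
pose T (w0 : W) := hash_phases R L b (pr w0.1) w0.2 (enum 'I_s) ([::] : seq 'rV[int]_w).
(* All the randomness is the coordinator's, so private coins suffice. *)
exists W, (protocol_uncoin id (m := coordinator_model)
  (coord_of_tree T (hash_reply (s := s) (d := d) L b))).
move=> I bI; pose x := held I; pose X := flatten [seq x i | i <- enum 'I_s].
have i0 F : indep F ([::] : seq 'rV[int]_w).
  by rewrite /indep eqn_leq rank_leq_row leq0n.
have runE w0 : exists V', [/\ indep 'F_(pr w0.1) V',
    good 'F_(pr w0.1) w0.2 [::] X -> V' = greedy 'F_(pr w0.1) [::] X &
    coord_run_from (coord_of_tree T (hash_reply (s := s) (d := d) L b)) w0 x c [::] =
    Some (solve R V')].
  have [V' [iV' _ gV' e]] := ceval_hash_phases (x := x) R w0.2 (pr_prime w0.1) (pr_lt w0.1)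
    (fun i r => bounded_held bI) (i0 _) (enum_uniq 'I_s) (h := [::]) (fun i _ => erefl).
  exists V'; split=> //.
  rewrite run_coord_of_tree /T e //= subn0 size_enum_ord /c leq_add // leq_mul //.
  exact: indep_size iV'.
have bX r : r \in X -> bounded_row L r.
  by case/flatten_mapP => i _; apply: bounded_held.
have [D [D0 Dle rkD]] := rank_drop_divisor R (expn_gt0 2 L)
  (fun i j => rows_mx_bounded i j bX).
pose G (w0 : W) := ~~ (pr w0.1 %| D)%N && good 'F_(pr w0.1) w0.2 [::] X.
have Gcorrect w0 V' : G w0 -> indep 'F_(pr w0.1) V' ->
    V' = greedy 'F_(pr w0.1) [::] X -> correct I (solve R V').
  move=> /andP[pD _] iV' V'E.
  have V'X : {subset V' <= X} by move=> r; rewrite V'E => /greedy_mem[].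
  have XV' : all (inspan 'F_(pr w0.1) V') X.
    by apply/allP => r rX; rewrite V'E; apply: greedy_inspanr.
  have := span_lift (pr_prime _) pD rkD iV' V'X XV' => /allP XRV'.
  apply: correct_solve => [r /V'X /flatten_mapP[i _ /mem_held]|j]; first by right.
  apply: XRV'; apply/flatten_mapP; exists (holder I j); first by rewrite mem_enum.
  exact: inrow_held.
split=> [w0|].
  rewrite (run_uncoin id (m := coordinator_model)).
  by have [V' [_ _]] := runE w0.1; rewrite /run => ->.
apply: (@proba_fst R W _ G).
- by rewrite card_prod card_ord card_ffun !card_ord muln_gt0 N0 expn_gt0 muln_gt0 addn1.
- by rewrite card_ffun card_prod card_ord card_ffun !card_ord !expn_gt0 muln_gt0 N0 expn_gt0 muln_gt0 addn1.
- move=> w0 Gw0; rewrite (run_uncoin id (m := coordinator_model)).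
  have [V' [iV' gV' e]] := runE w0.1; exists (solve R V') => //.
  by apply: (Gcorrect w0.1) => //; apply: gV'; case/andP: Gw0.
pose cnt := #|[pred k : 'I_N | (pr k %| D)%N]|.
have cnt_le : (cnt <= w * (w + L))%N.
  rewrite -(leq_exp2l (m := 2)) //.
  have h : (2 ^ cnt <= D)%N.
    rewrite /cnt cardE -(size_map pr); apply: primes_dvd_leq => //.
    + rewrite map_inj_in_uniq ?enum_uniq // => k k' _ _ /eqP.
      by rewrite nth_uniq ?filter_uniq // => /eqP/val_inj.
    + by apply/allP => _ /mapP[k _ ->].
    + by apply/allP => _ /mapP[k + ->]; rewrite mem_enum.
  apply: leq_trans h (leq_trans Dle _).
  apply: leq_trans (leq_mul (leq_fact_exp2 w) (leqnn _)) _.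
  rewrite -expnM -expnD leq_exp2l //; lia.
have badk k : (200 * #|[pred u : {ffun 'I_w -> 'I_K} | ~~ G (k, u)]| <=
    200 * (pr k %| D) * K ^ w + K ^ w)%N.
  case pD: (pr k %| D)%N.
    rewrite muln1; apply: leq_trans (leq_addr _ _); rewrite leq_mul2l /=.
    by apply: leq_trans (max_card _) _; rewrite card_ffun !card_ord.
  rewrite muln0 mul0n add0n.
  have := card_not_good X (pr_prime k) (pr_ge k) (i0 _).
  rewrite subn0 /G /= pD /= {2}/K.
  move: (K ^ w)%N #|[pred u : {ffun 'I_w -> 'I_K} | ~~ good 'F_(pr k) u [::] X]|.
  move=> M S; have w0 : (0 < w)%N by rewrite addn1.
  have -> : (S * (200 * w) = w * (200 * S))%N by lia.
  by rewrite leq_pmul2l.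
have -> : #|[pred w0 : W | ~~ G w0]| =
    (\sum_(k < N) #|[pred u : {ffun 'I_w -> 'I_K} | ~~ G (k, u)]|)%N.
  rewrite -sum1_card; under [RHS]eq_bigr do rewrite -sum1_card.
  rewrite pair_big_dep; apply: eq_bigl => -[k u] //.
have : (200 * \sum_(k < N) #|[pred u : {ffun 'I_w -> 'I_K} | ~~ G (k, u)]| <=
    200 * cnt * K ^ w + N * K ^ w)%N.
  rewrite big_distrr /=; 
  apply: (@leq_trans (\sum_(k < N) (200 * (pr k %| D)%N * K ^ w + K ^ w))%N).
    by apply: leq_sum => k _; apply: badk.
  rewrite big_split /= sum_nat_const card_ord leq_add2r.
  have -> : cnt = (\sum_(k < N) (pr k %| D))%N.
    rewrite /cnt -sum1_card big_mkcond /=; apply: eq_bigr => k _.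
    by rewrite inE; case: (_ %| _)%N.
  by rewrite -big_distrl -big_distrr.
rewrite card_prod card_ffun !card_ord.
move: (K ^ w)%N (\sum_(_ < _) _)%N => M S h; nia.
Qed.

End RandomizedProtocol.

(** * Histories of coordinator protocols *)

Section Traces.
Variables (s : nat) (X O : Type) (P : coord_protocol s unit X O).
Implicit Types (x y : 'I_s -> X) (h H : seq ('I_s * (direction * bool))).

Fixpoint coord_trace x (c : nat) h : option (seq ('I_s * (direction * bool)) * O) :=
  match coord_next P tt h, c with
  | Output o, _ => Some (h, o)
  | Tell i a, c'.+1 => coord_trace x c' (rcons h (i, (to_server, a)))
  | Ask i, c'.+1 =>
      coord_trace x c' (rcons h (i, (to_coordinator,
                                     coord_reply P i (x i) (channel i h))))
  | _, 0%N => None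
  end.

Lemma run_trace x c h : coord_run_from P tt x c h = omap snd (coord_trace x c h).
Proof.
elim: c h => [|c IH] h /=; first by case: coord_next.
by case: coord_next => [i a|i|out] //.
Qed.

Definition consistent i (y : X) (ch : seq (direction * bool)) :=
  forall ch1 b ch2, ch = ch1 ++ (to_coordinator, b) :: ch2 ->
    b = coord_reply P i y ch1.

Lemma trace_extends x c h H out : coord_trace x c h = Some (H, out) ->
  exists2 h', H = h ++ h' & (size h' <= c)%N.
Proof.
elim: c h => [|c IH] h /=.
  by case: coord_next => // out' [<- _]; exists [::]; rewrite ?cats0.
case: coord_next => [i a|i|out'].
- by move=> /IH[h' -> sh']; exists ((i, (to_server, a)) :: h') => //; rewrite cat_rcons.
- by move=> /IH[h' -> sh']; eexists (_ :: h'); [rewrite cat_rcons|].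
- by case=> <- _; exists [::]; rewrite ?cats0.
Qed.

Lemma consistent_rcons i (y : X) ch e : consistent i y ch ->
  (forall b, e = (to_coordinator, b) -> b = coord_reply P i y ch) ->
  consistent i y (rcons ch e).
Proof.
move=> cch ce ch1 b ch2; case: (lastP ch2) => [|ch2' e2].
  by rewrite cats1 => /rcons_inj[<- /ce].
by rewrite -rcons_cons -rcons_cat => /rcons_inj[/cch].
Qed.

Lemma channel_rcons_other (i j : 'I_s) h m : i != j ->
  channel j (rcons h (i, m)) = channel j h.
Proof.
by move=> ij; rewrite -cats1 channel_cat (channel_other [:: m] ij) cats0.
Qed.

Lemma trace_consistent x c H out :
  coord_trace x c [::] = Some (H, out) -> forall i, consistent i (x i) (channel i H).
Proof.
have : forall i, consistent i (x i) (channel i [::]) by move=> i [|? ?].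
elim: c [::] => [|c IH] h hc /=.
  by case: coord_next => // out' [<- _].
case: coord_next => [i a|i|out']; last by case=> <- _.
- apply: IH => j; case: (eqVneq i j) => [<-|ij].
    by rewrite channel_rcons; apply: consistent_rcons.
  by rewrite channel_rcons_other.
- apply: IH => j; case: (eqVneq i j) => [<-|ij].
    by rewrite channel_rcons; apply: consistent_rcons => // b [].
  by rewrite channel_rcons_other.
Qed.

(* The rectangle property. *)
Lemma trace_paste x y c h H out :
  coord_trace x c h = Some (H, out) ->
  (forall i, consistent i (y i) (channel i H)) ->
  coord_trace y c h = Some (H, out).
Proof.
elim: c h => [|c IH] h /=; first by case: coord_next.
case: coord_next => [i a|i|out'] //; first exact: IH.
move=> e cy; have [h' HE _] := trace_extends e.
have <- : coord_reply P i (x i) (channel i h) = coord_reply P i (y i) (channel i h).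
  apply: (cy i (channel i h) _ (channel i h')).
  by rewrite HE channel_cat channel_rcons cat_rcons.
exact: IH.
Qed.

Lemma sum_channel_size h : (\sum_(i < s) size (channel i h) = size h)%N.
Proof.
elim: h => [|[i m] h IH]; first by rewrite big1.
rewrite /= -IH -add1n (bigD1 i) //= [X in (_ = 1 + X)%N](bigD1 i) //= /channel /= eqxx /= addSn.
congr (_ + _).+1; apply: eq_bigr => j ji; rewrite ifN //.
by rewrite eq_sym.
Qed.

Lemma trace_size x c H out : coord_trace x c [::] = Some (H, out) ->
  (\sum_(i < s) size (channel i H) <= c)%N.
Proof. by move=> /trace_extends[h' -> ?]; rewrite sum_channel_size. Qed.

End Traces.

(** * Counting transcripts of bounded length *)

Section Padding.
Variable T : finType.

(** [None] marks the end, so words of length at most [l] embed in a set of size [(#|T| + 1) ^ l].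
    This gives base 3 for boards and base 5 for channels, whose symbols are bits with a
    direction. *)
Definition pad l (t : seq T) : l.-tuple (option T) :=
  [tuple nth None (map some t) i | i < l].

Lemma pad_inj l (t t' : seq T) : (size t <= l)%N -> (size t' <= l)%N ->
  pad l t = pad l t' -> t = t'.
Proof.
move=> tl tl' e.
have ne i : nth None (map some t) i = nth None (map some t') i.
  have [il|il] := ltnP i l; last by rewrite !nth_default ?size_map ?(leq_trans _ il).
  by have := congr1 (fun u => tnth u (Ordinal il)) e; rewrite !tnth_mktuple.
have st : forall u v : seq T,
    (forall i, nth None (map some u) i = nth None (map some v) i) -> (size u <= size v)%N.
  move=> [|z u] v h //; rewrite leqNgt; apply/negP => /=; rewrite ltnS => vu.
  have := h (size u); rewrite [RHS]nth_default ?size_map //.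
  by rewrite (nth_map z) //= .
have mE : map some t = map some t'.
  apply: (@eq_from_nth _ None) => [|i _] //.
  by rewrite !size_map; apply/eqP; rewrite eqn_leq !st.
by elim: t t' mE {tl tl' e ne} => [|a t IH] [|b t'] //= [-> /IH ->].
Qed.

Lemma card_pad l : #|{: l.-tuple (option T)}| = (#|T|.+1 ^ l)%N.
Proof. by rewrite card_tuple card_option. Qed.

End Padding.

(* [direction] has no finType structure. *)
Definition code_dir (e : direction * bool) : bool * bool :=
  (if e.1 is to_server then true else false, e.2).

Lemma code_dir_inj : injective code_dir.
Proof. by case=> [[] b] [[] b'] // [->]. Qed.

Section Instances.
Variables (R : realType) (s n d : nat).

Definition linsys_of (rows : 'I_n -> 'rV[int]_(d + 1)) (hold : 'I_n -> 'I_s) :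
    linsys s n d :=
  let A := \matrix_i rows i in LinSys (lsubmx A) (rsubmx A) hold.

Lemma inrow_linsys_of rows hold j : inrow (linsys_of rows hold) j = rows j.
Proof. by rewrite /inrow /= hsubmxK rowK. Qed.

Lemma bounded_linsys_of L rows hold : (forall j, bounded_row L (rows j)) ->
  entries_bounded L (linsys_of rows hold).
Proof. by move=> b; split=> [i j|i]; rewrite !mxE; apply: b. Qed.

Lemma solution_linsys_of rows hold (x : 'cV[R]_d) :
  solution (linsys_of rows hold) x <-> forall j, solves x (rows j).
Proof.
rewrite solution_rows; split=> h j; have := h j; by rewrite inrow_linsys_of.
Qed.

Lemma solvesE (x : 'cV[R]_d) r :
  solves x r <-> \sum_j (r 0 (lshift 1 j))%:~R * x j 0 = (r 0 (rshift d 0))%:~R.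
Proof.
have e : (map_mx intr r *m col_mx x (- 1%:M)) 0 0 =
    \sum_j (r 0 (lshift 1 j))%:~R * x j 0 - (r 0 (rshift d 0))%:~R.
  rewrite mxE big_split_ord big_ord1 /=; congr (_ + _).
    by apply: eq_bigr => j _; rewrite col_mxEu mxE.
  by rewrite col_mxEd !mxE eqxx mulrN mulr1.
split=> [h|h].
  by apply/eqP; rewrite -subr_eq0 -e; move: h; rewrite /solves => ->; rewrite mxE.
by apply/matrixP => a b; rewrite !ord1 e h subrr mxE.
Qed.

Lemma solves0 (x : 'cV[R]_d) : solves x 0.
Proof. by rewrite /solves map_mx0 mul0mx. Qed.

End Instances.

(** * A family of systems with distinct solutions *)

Lemma digits_inj (B m : nat) (a a' : nat -> nat) : (0 < B)%N ->
  (forall t, a t < B)%N -> (forall t, a' t < B)%N ->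
  (\sum_(t < m) a t * B ^ t = \sum_(t < m) a' t * B ^ t)%N ->
  forall t, (t < m)%N -> a t = a' t.
Proof.
move=> B0; elim: m a a' => // m IH a a' aB a'B; rewrite !big_ord_recl /= !muln1.
have shift (c : nat -> nat) : (\sum_(i < m) c (bump 0 i) * B ^ bump 0 i =
    (\sum_(i < m) c i.+1 * B ^ i) * B)%N.
  by rewrite big_distrl; apply: eq_bigr => i _; rewrite /bump leq0n add1n expnSr mulnA.
rewrite !shift => e.
have mod0 c S : (c < B)%N -> ((c + S * B) %% B = c)%N.
  by move=> cB; rewrite addnC modnMDl modn_small.
have e0 : a 0%N = a' 0%N.
  by have := congr1 (modn^~ B) e; rewrite /= !mod0.
move: e; rewrite e0 => /addnI/eqP; rewrite eqn_pmul2r // => /eqP e [|t] // tm.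
exact: (IH (fun t => a t.+1) (fun t => a' t.+1)).
Qed.

Section BlockSystem.
Variables (R : realType) (m k L : nat).
Local Notation d := (m + k).+1.
Local Notation B := (2 ^ L)%N.

Definition digits := {ffun 'I_k.+1 * 'I_m.+1 -> 'I_(2 ^ L)}.

Definition digit (a : digits) (i t : nat) : nat := a (inord i, inord t).

(* Unknowns [y_t] for [t < m] and [z_i] for [i <= k], with equations
   [B y_t = y_(t+1)], where [y_m = 1], and [z_i = sum_(t <= m) a_it y_t]; so
   [y_t = B^(t-m)], and [z_i] has the base-[B] digits [a_it]. *)
Definition block_row (a : digits) (r : nat) : 'rV[int]_(d + 1) :=
  \row_(j < d + 1)
    if (r < m)%N then
      if (j == r :> nat) then B%:Z
      else if (j == r.+1 :> nat) && (j < m)%N then -1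
      else ((r.+1 == m) && (j == d :> nat))%:Z
    else if (j < m)%N then - (digit a (r - m) j)%:Z
    else if (j == d :> nat) then (digit a (r - m) m)%:Z
    else (j == r :> nat)%:Z.

Lemma bounded_block_row a r : bounded_row L (block_row a r).
Proof.
move=> j; rewrite mxE powZE.
have B0 : (0 < B)%N by rewrite expn_gt0.
have aB i t : (digit a i t < B)%N by apply: ltn_ord.
have := aB (r - m)%N j; have := aB (r - m)%N m.
case: ifP => _; case: ifP => _; try case: ifP => _; lia.
Qed.

Definition unknown (x : 'cV[R]_d) (j : nat) : R := x (inord j) 0.

Definition ladder (x : 'cV[R]_d) (t : nat) : R := if (t < m)%N then unknown x t else 1.

Lemma solves_ladder (x : 'cV[R]_d) a t : (t < m)%N ->
  solves x (block_row a t) <-> B%:R * ladder x t = ladder x t.+1.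
Proof.
move=> tm; rewrite solvesE.
have td : (t < d)%N by lia.
rewrite (bigD1 (Ordinal td)) //= !mxE /= tm eqxx.
have -> : ladder x t = x (Ordinal td) 0.
  by rewrite /ladder /unknown tm; congr (x _ 0); apply/val_inj; rewrite /= inordK.
rewrite /ladder; have [t1m|mt1] := ltnP t.+1 m.
  have t1d : (t.+1 < d)%N by lia.
  rewrite (bigD1 (Ordinal t1d)) /=; last by rewrite -val_eqE /= neq_ltn ltnSn orbT.
  rewrite big1 ?addr0; last first.
    move=> j /andP[jt jt1]; rewrite mxE /= tm.
    rewrite (negbTE (jt : (j : nat) != t)) (negbTE (jt1 : (j : nat) != t.+1)) /=.
    by rewrite (_ : (t.+1 == m) = false) ?mul0r //; lia.
  rewrite mxE /= tm eqxx t1m (_ : (t.+1 == t) = false); last lia.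
  rewrite (_ : (d + 0 == t)%N = false); last lia.
  rewrite (_ : (d + 0 == t.+1)%N = false); last lia.
  rewrite (_ : (t.+1 == m) = false) /=; last lia.
  have -> : unknown x t.+1 = x (Ordinal t1d) 0.
    by rewrite /unknown; congr (x _ 0); apply/val_inj; rewrite /= inordK.
  rewrite mulN1r -pmulrn; split=> [/eqP|->]; last by rewrite addrN.
  by rewrite subr_eq0 => /eqP.
have t1E : t.+1 = m by lia.
rewrite big1 => [|j jt]; last first.
  rewrite mxE /= tm t1E eqxx (negbTE (jt : (j : nat) != t)) /=.
  rewrite (_ : (j == m :> nat) && (j < m)%N = false); last lia.
  by rewrite (_ : (j == d :> nat) = false) ?mul0r //; have := ltn_ord j; lia.
rewrite t1E eqxx (_ : (d + 0 == t)%N = false); last lia.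
rewrite (_ : (d + 0 == m)%N && _ = false) /=; last lia.
by rewrite addn0 eqxx addr0 -pmulrn.
Qed.

Lemma solves_digits (x : 'cV[R]_d) a i : (i <= k)%N ->
  solves x (block_row a (m + i)) <->
  unknown x (m + i) = \sum_(t < m.+1) (digit a i t)%:R * ladder x t.
Proof.
move=> ik; rewrite solvesE [\sum_(t < m.+1) _]big_ord_recr /= [ladder x m]/ladder ltnn mulr1.
have -> : \sum_(j < d) (block_row a (m + i) 0 (lshift 1 j))%:~R * x j 0 =
    unknown x (m + i) - \sum_(t < m) (digit a i t)%:R * ladder x t.
  have mid : (m + i < d)%N by lia.
  rewrite (bigD1 (Ordinal mid)) //= mxE /= addKn.
  rewrite (_ : (m + i < m)%N = false); last lia.
  rewrite (_ : (m + i == d)%N = false); last lia.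
  rewrite eqxx mul1r; congr (_ + _).
    by rewrite /unknown; congr (x _ 0); apply/val_inj; rewrite /= inordK.
  rewrite -sumrN.
  transitivity (\sum_(j < d | (j < m)%N) - ((digit a i j)%:R * ladder x j)).
    rewrite [RHS]big_mkcond [LHS]big_mkcond /=; apply: eq_bigr => j _.
    rewrite -val_eqE /= mxE /= addKn (_ : (m + i < m)%N = false); last lia.
    have [jm|mj] := ltnP j m.
      rewrite (_ : (j != m + i :> nat)); last lia.
      by rewrite /ladder jm /unknown inord_val mulrNz mulNr.
    case: eqP => //= jmi; rewrite (_ : (j == d :> nat) = false) ?mul0r //.
    by have := ltn_ord j; lia.
  have md : (m <= d)%N by lia.
  rewrite (big_ord_widen d (fun t => - ((digit a i t)%:R * ladder x t)) md).
  by [].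
rewrite mxE /= addKn addn0 eqxx.
rewrite (_ : (m + i < m)%N = false); last lia.
rewrite (_ : (d < m)%N = false); last lia.
rewrite -pmulrn; split=> [<-|->]; first by rewrite addrC subrK.
by rewrite addrAC subrr add0r.
Qed.

Definition block_solution (a : digits) : 'cV[R]_d :=
  let lad t := B%:R ^+ t / B%:R ^+ m in
  \col_(j < d) if (j < m)%N then lad j
    else \sum_(t < m.+1) (digit a (j - m) t)%:R * lad t.

Lemma Bneq0 : B%:R != 0 :> R.
Proof. by rewrite pnatr_eq0 expn_eq0. Qed.

Lemma block_solutionP a r : (r < d)%N -> solves (block_solution a) (block_row a r).
Proof.
have ladE t : (t <= m)%N -> ladder (block_solution a) t = B%:R ^+ t / B%:R ^+ m.
  rewrite leq_eqVlt => /orP[/eqP ->|tm].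
    by rewrite /ladder ltnn divff // expf_neq0 // Bneq0.
  by rewrite /ladder tm /unknown mxE inordK ?tm //; lia.
move=> rd; have [rm|mr] := ltnP r m.
  by apply/solves_ladder => //; rewrite !ladE ?(ltnW rm) // exprS mulrA.
rewrite -(subnKC mr); apply/solves_digits; first lia.
rewrite /unknown mxE inordK ?subnKC // ltnNge mr /=.
by apply: eq_bigr => t _; rewrite ladE // -ltnS.
Qed.

(** The ladder forces [y_t = y_0 B^t], with [y_0] nonzero because [y_m = 1]. Dividing [z_i] by [y_0]
    leaves a natural number whose base-[B] digits are the [a_it]. *)
Lemma block_inj (x : 'cV[R]_d) a a' :
  (forall r, (r < d)%N -> solves x (block_row a r)) ->
  (forall r, (r < d)%N -> solves x (block_row a' r)) -> a = a'.
Proof.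
move=> xa xa'.
have lad t : (t <= m)%N -> ladder x t = ladder x 0 * B%:R ^+ t.
  elim: t => [|t IH] tm; first by rewrite mulr1.
  have := xa t; rewrite solves_ladder // => <-; last lia.
  by rewrite IH ?(ltnW tm) // exprS mulrCA.
have lad0 : ladder x 0 != 0.
  apply/eqP => l0; have := lad m (leqnn m); rewrite l0 mul0r /ladder ltnn.
  by apply/eqP; rewrite oner_eq0.
have sumE a0 i : (i <= k)%N -> (forall r, (r < d)%N -> solves x (block_row a0 r)) ->
    unknown x (m + i) = ladder x 0 * (\sum_(t < m.+1) digit a0 i t * B ^ t)%N%:R.
  move=> ik h; have := h (m + i)%N; rewrite solves_digits // => ->; last lia.
  rewrite natr_sum mulr_sumr; apply: eq_bigr => t _.
  by rewrite (lad t (leq_ord t)) natrM [in RHS]natrX mulrCA.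
apply/ffunP => -[i t]; apply/val_inj.
have ik : (i <= k)%N by rewrite -ltnS.
have := sumE a i ik xa; rewrite (sumE a' i ik xa') => /(mulfI lad0)/eqP.
rewrite eqr_nat => /eqP /digits_inj e.
have := e; rewrite expn_gt0 => /(_ isT) /(_ (fun t => ltn_ord _) (fun t => ltn_ord _)).
by move=> /(_ t (ltn_ord t)); rewrite /digit !inord_val.
Qed.

Lemma card_digits : #|{: digits}| = (2 ^ (L * (k.+1 * m.+1)))%N.
Proof. by rewrite card_ffun card_prod !card_ord -expnM. Qed.

End BlockSystem.

(** * Lower bounds by counting *)

Lemma proba_card (R : realType) (W : finType) (E : W -> Prop) :
  99%:R / 100%:R <= proba R E ->
  (0 < #|W|)%N /\ (99 * #|W| <= 100 * #|[pred w | `[< E w >]]|)%N.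
Proof.
rewrite /proba; case: (posnP #|W|) => [->|W0 h].
  by rewrite invr0 mulr0 => h; exfalso; move: h; apply/negP; rewrite -ltNge divr_gt0 ?ltr0n.
split=> //; move: h; rewrite ler_pdivlMr ?ltr0n // mulrAC ler_pdivrMr ?ltr0n //.
by rewrite -!natrM ler_nat [X in (_ <= X)%N]mulnC.
Qed.

Lemma sum_card_pred (A W : finType) (E : A -> W -> bool) :
  (\sum_a #|[pred w | E a w]| = \sum_w #|[pred a | E a w]|)%N.
Proof.
under eq_bigr do rewrite -sum1_card big_mkcond /=.
rewrite exchange_big /=; apply: eq_bigr => w _.
by rewrite -sum1_card [RHS]big_mkcond; apply: eq_bigr => a _; rewrite !inE.
Qed.

Lemma sumT_const (T : finType) (k : nat) : (\sum_(i : T) k = #|T| * k)%N.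
Proof. by rewrite sum_nat_const; congr (_ * _)%N; apply: eq_card. Qed.

(** Double counting of the good pairs: the easy half of Yao's principle, used to fix the coins. *)
Lemma averaging (A W : finType) (E : A -> W -> bool) (p q : nat) :
  (0 < #|W|)%N -> (forall a, p * #|W| <= q * #|[pred w | E a w]|)%N ->
  exists w, (p * #|A| <= q * #|[pred a | E a w]|)%N.
Proof.
move=> W0 h; apply/existsP; apply: contraT; rewrite negb_exists => /forallP hn.
have h1 : (\sum_(a : A) p * #|W| <= q * \sum_a #|[pred w | E a w]|)%N.
  by rewrite big_distrr; apply: leq_sum => a _.
have h2 : (q * \sum_w #|[pred a | E a w]| + #|W| <= \sum_(w : W) p * #|A|)%N.
  rewrite big_distrr /= -sum1_card -big_split /=.
  by apply: leq_sum => w _; rewrite addn1 ltnNge.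
move: h1 h2; rewrite sum_card_pred !sumT_const => h1 h2; exfalso; nia.
Qed.

Lemma leq_exp_base m n e : (m <= n)%N -> (m ^ e <= n ^ e)%N.
Proof. by case: e => // e mn; rewrite leq_exp2r. Qed.

Section BoardRuns.
Variables (s : nat) (X O : Type) (P : board_protocol s unit X O).
Implicit Types (x y : 'I_s -> X).

Lemma board_run_output x c h out : board_run_from P tt x c h = Some out ->
  exists2 H, (size H <= size h + c)%N & out = board_output P tt H.
Proof.
elim: c h => [|c IH] h /=.
  by case: board_turn => [[|i]|] // [<-]; exists h; rewrite ?addn0.
case: board_turn => [[|i]|].
- by move=> /IH[H]; rewrite size_rcons addSnnS; exists H.
- by move=> /IH[H]; rewrite size_rcons addSnnS; exists H.
- by case=> <-; exists h => //; apply: leq_addr.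
Qed.

Fixpoint speakers x c h : seq 'I_s :=
  if c is c'.+1 then
    match board_turn P h with
    | None => [::]
    | Some (Coordinator) => speakers x c' (rcons h (board_coord P tt h))
    | Some (Server i) => i :: speakers x c' (rcons h (board_server P i (x i) h))
    end
  else [::].

Lemma size_speakers x c h : (size (speakers x c h) <= c)%N.
Proof.
elim: c h => //= c IH h; case: board_turn => [[|i]|] //=; last exact: IH.
exact: leq_trans (IH _) (leqnSn c).
Qed.

Lemma silent_run x y c h i : (forall j, j != i -> x j = y j) ->
  i \notin speakers x c h -> board_run_from P tt x c h = board_run_from P tt y c h.
Proof.
move=> xy; elim: c h => [|c IH] h /=; first by case: board_turn => [[|j]|].
case: board_turn => [[|j]|] //; first exact: IH.
by rewrite inE negb_or => /andP[ij]; rewrite xy 1?eq_sym //; apply: IH.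
Qed.

End BoardRuns.

Section OneServerBound.
Variables (R : realType) (s n m k L : nat).
Local Notation d := (m + k).+1.
Hypotheses (s0 : (0 < s)%N) (dn : (d <= n)%N).

Definition one_server (a : digits m k L) : linsys s n d :=
  linsys_of (fun j : 'I_n => if (j < d)%N then block_row a j else 0)
    (fun=> Ordinal s0).

Lemma one_server_bounded a : entries_bounded L (one_server a).
Proof.
apply: bounded_linsys_of => j; case: ifP => _; first exact: bounded_block_row.
by move=> i; rewrite mxE normr0 exprn_ge0.
Qed.

Lemma solution_one_server (x : 'cV[R]_d) a :
  solution (one_server a) x <-> forall r, (r < d)%N -> solves x (block_row a r).
Proof.
rewrite solution_linsys_of; split=> [h r rd|h j].
  by have := h (Ordinal (leq_trans rd dn)); rewrite /= rd.
by case: ifP => [/h //|_]; apply: solves0.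
Qed.

Lemma correct_one_server a o : correct (R := R) (one_server a) o ->
  exists2 x, o = Some x & forall r, (r < d)%N -> solves x (block_row a r).
Proof.
case: o => [x /solution_one_server|]; first by exists x.
case; exists (block_solution R a); apply/solution_one_server.
exact: block_solutionP.
Qed.

(** Some coin is right on 99 percent of the digit arrays. On these the final board fixes the output
    and hence the array, and there are at most [3 ^ c <= 4 ^ c] padded boards; the extra 1 absorbs
    the factor 100/99. *)
Lemma public_board_output_bound c :
  randomly_solvable R public_coins blackboard_model s n d L c ->
  (L * (k.+1 * m.+1) <= 2 * c + 1)%N.
Proof.
case=> W [P HP].
pose res a w := run (m := blackboard_model) (P w) tt (held (one_server a)) c.
have HP1 a : (0 < #|W|)%N /\
    (99 * #|W| <= 100 * #|[pred w | `[< succeeds (R := R) (one_server a) (res a w) >]]|)%N.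
  by apply: (@proba_card R); have [] := HP _ (one_server_bounded a).
have [W0 _] := HP1 [ffun=> Ordinal (expn_gt0 2 L : (0 < 2 ^ L)%N)].
have [w] := averaging W0 (fun a => (HP1 a).2).
rewrite card_digits; set S := [pred a | _] => hS.
have inS a : a \in S -> exists H, exists x, [/\ (size H <= c)%N,
    board_output (P w) tt H = Some x &
    forall r, (r < d)%N -> solves x (block_row a r)].
  move=> aS; have /asboolP[ o ro /correct_one_server[x oE xa]] :
    `[< succeeds (R := R) (one_server a) (res a w) >] := aS.
  have [H sH HE] := board_run_output ro.
  by exists H, x; split=> //; rewrite -HE.
pose H (a : digits m k L) := if pselect (exists H, exists x, [/\ (size H <= c)%N,
    board_output (P w) tt H = Some x &
    forall r, (r < d)%N -> solves x (block_row a r)]) is left e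
  then projT1 (cid e) else [::].
have HS a : a \in S -> exists x, [/\ (size (H a) <= c)%N,
    board_output (P w) tt (H a) = Some x &
    forall r, (r < d)%N -> solves x (block_row a r)].
  by move=> aS; rewrite /H; case: pselect => [e|]; [case: (cid e)|case; apply: inS].
have Hinj : {in S &, injective (fun a => pad c (H a))}.
  move=> a a' /HS[x [sa oa xa]] /HS[x' [sa' oa' xa']] /(pad_inj sa sa') e.
  move: oa'; rewrite -e oa => -[xx']; rewrite -xx' in xa'.
  exact: block_inj xa xa'.
have SC : (#|S| <= 3 ^ c)%N.
  rewrite -(card_in_image Hinj); apply: leq_trans (max_card _) _.
  by rewrite card_pad card_bool.
have : (2 ^ (L * (k.+1 * m.+1)) <= 2 ^ (2 * c + 1))%N.
  have h34 : (3 ^ c <= 2 ^ (2 * c))%N by rewrite expnM leq_exp_base.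
  rewrite expnD; move: hS SC h34; move: (_ ^ _)%N (3 ^ c)%N (2 ^ (2 * c))%N => M T U.
  lia.
by rewrite leq_exp2l.
Qed.

End OneServerBound.

Section SpeakingBound.
Variables (R : realType) (s n d L : nat).
Hypotheses (s2 : (2 <= s)%N) (d0 : (0 < d)%N) (sn : (s <= n)%N).

Definition first_row (b : bool) : 'rV[int]_(d + 1) :=
  \row_j if (j == 0 :> nat) then 1 else ((j == d :> nat) && b)%:Z.

Lemma solves_first_row (x : 'cV[R]_d) b : solves x (first_row b) <->
  x (Ordinal d0) 0 = b%:R.
Proof.
rewrite solvesE (bigD1 (Ordinal d0)) //= big1 ?addr0 => [|j j0]; last first.
  rewrite mxE /= (negbTE (j0 : (j : nat) != 0%N)) (_ : (j == d :> nat) = false) ?mul0r //.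
  by have := ltn_ord j; lia.
rewrite !mxE /= mul1r addn0 eqxx (_ : (d == 0)%N = false); last lia.
by rewrite andTb -pmulrn.
Qed.

Lemma s_gt0 : (0 < s)%N. Proof. exact: ltnW. Qed.

(** Each server asserts [x_0 = 0], except that server [i], if any, asserts [x_0 = 1]. As [s >= 2],
    some other server then contradicts it. *)
Definition flipped (i : option 'I_s) : linsys s n d :=
  linsys_of (fun j : 'I_n => if (j < s)%N then first_row (Some (nat_of_ord j) == omap val i) else 0)
    (fun j => if insub (nat_of_ord j) is Some i' then i' else Ordinal s_gt0).

Lemma flipped_bounded i : entries_bounded L (flipped i).
Proof.
apply: bounded_linsys_of => j; case: ifP => _ k; rewrite mxE ?powZE.
  have : (0 < 2 ^ L)%N by rewrite expn_gt0.
  by case: ifP => _; last case: (_ && _); lia.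
by rewrite normr0.
Qed.

Lemma held_flipped i j : j != i -> held (flipped None) j = held (flipped (Some i)) j.
Proof.
move=> ji; apply: held_ext => // j' hj'; rewrite !inrow_linsys_of.
case: ifP => // j's; congr first_row; apply/esym/eqP => -[e].
by move: hj' ji; rewrite /= insubT -val_eqE /= => <- /=; rewrite e eqxx.
Qed.

(** For at least 98 percent of the coins the protocol is right both on [flipped None] and on
    [flipped (Some i)]. The answers differ, so server [i] must speak on [flipped None]. Summing over
    [i] bounds the mean number of distinct speakers on this one input. *)
Lemma public_board_speaking_bound c :
  randomly_solvable R public_coins blackboard_model s n d L c ->
  (98 * s <= 100 * c)%N.
Proof.
case=> W [P HP].
pose res i w := run (m := blackboard_model) (P w) tt (held (flipped i)) c.
pose ok i w := `[< succeeds (R := R) (flipped i) (res i w) >].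
have HP1 i : (0 < #|W|)%N /\ (99 * #|W| <= 100 * #|[pred w | ok i w]|)%N.
  by apply: (@proba_card R); have [] := HP _ (flipped_bounded i).
have W0 := (HP1 None).1.
pose sp w := speakers (P w) (held (flipped None)) c [::].
have spk i w : ok None w -> ok (Some i) w -> i \in sp w.
  move=> /asboolP[ o ro co] /asboolP[ o' ro' co'].
  apply: contraT => isp; have := silent_run (held_flipped (i := i)) isp.
  rewrite -[LHS]/(res None w) -[RHS]/(res (Some i) w) ro ro' => -[eo].
  have x0 : solution (flipped None) (0 : 'cV[R]_d).
    apply/solution_linsys_of => j; case: ifP => _; last exact: solves0.
    by apply/solves_first_row; rewrite mxE.
  case: o co eo {ro} => [x xI|nx _]; last by case: nx; exists 0.
  move=> eo; move: co'; rewrite -eo /= => /solution_linsys_of xI'.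
  have [i' i'i] : exists i' : 'I_s, i' != i.
    have h1 : (1 < s)%N by [].
    case: (eqVneq (Ordinal s_gt0) i) => [<-|]; last by exists (Ordinal s_gt0).
    by exists (Ordinal h1).
  have := xI' (Ordinal (leq_trans (ltn_ord i) sn)); rewrite /= ltn_ord eqxx.
  move=> /solves_first_row xi.
  have := xI' (Ordinal (leq_trans (ltn_ord i') sn)); rewrite /= ltn_ord.
  rewrite (_ : (Some _ == _) = false); last by apply/eqP => -[/val_inj e]; rewrite e eqxx in i'i.
  by move=> /solves_first_row; rewrite xi => /eqP; rewrite oner_eq0.
have cnt i : (98 * #|W| <= 100 * #|[pred w | i \in sp w]|)%N.
  pose A := [pred w | ok None w]; pose A' := [pred w | ok (Some i) w].
  have hU : (#|[predU A & A']| <= #|W|)%N := max_card _.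
  have hI : (#|[predI A & A']| <= #|[pred w | i \in sp w]|)%N.
    by apply/subset_leq_card/fintype.subsetP => w /andP[]; apply: spk.
  have hUI : (#|[predU A & A']| + #|[predI A & A']| = #|A| + #|A'|)%N := cardUI A A'.
  have hA : (99 * #|W| <= 100 * #|A|)%N := (HP1 None).2.
  have hA' : (99 * #|W| <= 100 * #|A'|)%N := (HP1 (Some i)).2.
  move: hU hI hUI hA hA'.
  move: #|W| #|A| #|A'| #|[predU A & A']| #|[predI A & A']| #|_| => *; lia.
have h1 : (\sum_(i < s) 98 * #|W| <= 100 * \sum_(i < s) #|[pred w | i \in sp w]|)%N.
  by rewrite big_distrr; apply: leq_sum => i _.
have h2 : (\sum_(w : W) #|[pred i | i \in sp w]| <= \sum_(w : W) c)%N.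
  apply: leq_sum => w _; apply: leq_trans (size_speakers (P w) (held (flipped None)) c [::]).
  exact: card_size.
move: h1; rewrite sum_card_pred => h1.
rewrite -(leq_pmul2l W0); move: (leq_trans h1 (leq_mul (leqnn 100) h2)).
by rewrite !sumT_const card_ord; lia.
Qed.

End SpeakingBound.

Section EqualityBound.
Variables (R : realType) (s n m k L : nat).
Local Notation d := (m + k).+1.
Hypotheses (s2 : (2 <= s)%N) (dn : (s * d <= n)%N).

Definition copies (f : 'I_s -> digits m k L) : linsys s n d :=
  linsys_of
    (fun j : 'I_n => if insub (j %/ d)%N is Some i then block_row (f i) (j %% d) else 0)
    (fun j => if insub (j %/ d)%N is Some i then i else Ordinal (ltnW s2)).

Lemma copies_bounded f : entries_bounded L (copies f).
Proof.
apply: bounded_linsys_of => j; case: insub => [i|]; first exact: bounded_block_row.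
by move=> i; rewrite mxE normr0 exprn_ge0.
Qed.

Lemma solution_copies (x : 'cV[R]_d) f : solution (copies f) x <->
  forall i r, (r < d)%N -> solves x (block_row (f i) r).
Proof.
rewrite solution_linsys_of; split=> [h i r rd|h j]; last first.
  by case: insub => [i|]; [apply: h; rewrite ltn_mod|apply: solves0].
have lt : (i * d + r < n)%N.
  apply: leq_trans dn; have : (i.+1 * d <= s * d)%N by rewrite leq_mul2r ltn_ord orbT.
  by rewrite mulSn; lia.
have := h (Ordinal lt); rewrite /= divnMDl // divn_small // addn0.
by rewrite valK modnMDl modn_small.
Qed.

Lemma held_copies f g i : f i = g i -> held (copies f) i = held (copies g) i.
Proof.
move=> fg; apply: held_ext => // j; rewrite !inrow_linsys_of /=.
by case: insub => [i' ->|//]; rewrite fg.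
Qed.

(** On inputs where all copies agree, each single channel determines the array. Fewer than [E / 3]
    bits on a channel leave room for at most half of the arrays, so every channel carries at least
    [E / 6] bits on average over the arrays. *)
Lemma deterministic_coordinator_bound c :
  deterministically_solvable R coordinator_model s n d L c ->
  (s * (L * (k.+1 * m.+1)) <= 6 * c)%N.
Proof.
case=> P HP; set E := (L * _)%N; pose A := digits m k L.
pose x f := held (copies f).
have trE f : exists H o, coord_trace P (x f) c [::] = Some (H, o) /\ correct (R := R) (copies f) o.
  have [ o ro co] := HP _ (copies_bounded f); move: ro; rewrite /= run_trace -/(x f).
  by case e: coord_trace => [[H o']|] //= [eo]; exists H, o; rewrite -eo -?eo // eo.
pose H (a : A) := projT1 (cid (trE (fun=> a))).
have HE a : exists o, coord_trace P (x (fun=> a)) c [::] = Some (H a, o) /\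
    correct (R := R) (copies (fun=> a)) o by exact: projT2 (cid (trE (fun=> a))).
have chinj i : injective (fun a => channel i (H a)).
  move=> a a' e; have [ o [tr co]] := HE a; have [ o' [tr' co']] := HE a'.
  (* The hybrid input: server [i] holds [a'], the others [a]. If the two runs agree on channel [i],
     the run on [a] is also the run on the hybrid, and its output solves both systems. *)
  pose f j := if j == i then a' else a.
  have tf : coord_trace P (x f) c [::] = Some (H a, o).
    apply: (trace_paste tr) => j; case: (eqVneq j i) => [->|ji].
      rewrite e (_ : x f i = x (fun=> a') i); first exact: trace_consistent tr' i.
      by apply: held_copies; rewrite /f eqxx.
    rewrite (_ : x f j = x (fun=> a) j); first exact: (trace_consistent tr).
    by apply: held_copies; rewrite /f (negbTE ji).
  have [ o2 ro2 co2] := HP _ (copies_bounded f).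
  have eo2 : o2 = o by move: ro2; rewrite /= run_trace -/(x f) tf => -[].
  case: o co {tr tf} eo2 => [z /solution_copies za|nz _]; last first.
    case: nz; exists (block_solution R a); apply/solution_copies => j r.
    exact: block_solutionP.
  move=> eo2; move: co2; rewrite eo2 /= => /solution_copies zf.
  apply: (@block_inj R m k L z) => r rd; first exact: (za i).
  by have := zf i r rd; rewrite /f eqxx.
have few i l : (#|[pred a : A | size (channel i (H a)) <= l]| <= 5 ^ l)%N.
  have inj : {in [pred a : A | size (channel i (H a)) <= l]%N &,
      injective (fun a => pad l (map code_dir (channel i (H a))))}.
    move=> a a'; rewrite !inE => la la' /pad_inj e; apply: (chinj i).
    by apply: (inj_map code_dir_inj); apply: e; rewrite size_map.
  rewrite -(card_in_image inj); apply: leq_trans (max_card _) _.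
  by rewrite card_pad card_prod card_bool.
have [E0|E0] := posnP E; first by rewrite E0 muln0.
(* So that [2 * 5 ^ l <= 2 * 8 ^ l <= 2 ^ E]. *)
pose l := (E.-1 %/ 3)%N.
have M2 : (2 * 5 ^ l <= #|A|)%N.
  rewrite card_digits -/E; apply: (@leq_trans (2 * 2 ^ (3 * l))%N).
    by rewrite leq_mul2l expnM leq_exp_base.
  rewrite -expnS leq_exp2l //; have := leq_trunc_div E.-1 3; rewrite /l; lia.
have long i : (#|A| * l.+1 <= 2 * \sum_a size (channel i (H a)))%N.
  have h : (\sum_(a : A) (l.+1 - l.+1 * (size (channel i (H a)) <= l)) <=
      \sum_a size (channel i (H a)))%N.
    apply: leq_sum => a _; case: (leqP (size (channel i (H a))) l) => ?; first by rewrite muln1 subnn.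
    by rewrite muln0 subn0.
  have h' : (\sum_(a : A) l.+1 <= \sum_(a : A) (l.+1 - l.+1 * (size (channel i (H a)) <= l))
      + l.+1 * #|[pred a : A | size (channel i (H a)) <= l]|)%N.
    have -> : #|[pred a : A | size (channel i (H a)) <= l]%N| =
        (\sum_(a : A) (size (channel i (H a)) <= l))%N.
      by rewrite -sum1_card big_mkcond; apply: eq_bigr => a _; rewrite inE; case: ifP.
    rewrite big_distrr -big_split /=.
    by apply: leq_sum => a _; case: (_ <= l)%N; lia.
  move: h'; rewrite sumT_const => h'.
  have f := few i l; move: h h' f M2; set S1 := (\sum_a _)%N; set S2 := (\sum_a _)%N.
  move: #|A| (5 ^ l)%N #|_| => M F q; nia.
have tot : (\sum_(i < s) \sum_a size (channel i (H a)) <= #|A| * c)%N.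
  rewrite exchange_big /= -sumT_const; apply: leq_sum => a _.
  by have [ o [tr _]] := HE a; apply: trace_size tr.
have : (\sum_(i < s) #|A| * l.+1 <= 2 * (#|A| * c))%N.
  apply: leq_trans (leq_mul (leqnn 2) tot).
  by rewrite big_distrr; apply: leq_sum => i _.
rewrite sumT_const card_ord.
have A0 : (0 < #|A|)%N by rewrite card_digits expn_gt0.
rewrite mulnCA [(2 * _)%N]mulnCA leq_pmul2l // => h.
have lE : (E <= 3 * l.+1)%N by have := ltn_ceil E.-1 (isT : (0 < 3)%N); rewrite /l; lia.
nia.
Qed.

End EqualityBound.

(** * Lower bound for randomized coordinator protocols *)

Section InnerProduct.
Variables (R : realType) (d : nat).
Local Notation A := {ffun 'I_d -> bool}.
Local Notation U := (A * A)%type.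
Implicit Types (a b : A) (u : U).

Definition ip a b : nat := \sum_j (a j && b j).

Definition balanced a u : bool := ip a u.1 == ip a u.2.

(** The violation visible modulo 2. A pair is neither balanced nor unmatched when the two products
    differ by a nonzero even number. *)
Definition unmatched a u : bool := odd (ip a u.1 + ip a u.2).

Definition sgn a u : R := (-1) ^+ (ip a u.1 + ip a u.2).

Lemma sgnE a u : sgn a u = (~~ unmatched a u)%:R - (unmatched a u)%:R.
Proof.
by rewrite /sgn -signr_odd -/(unmatched a u); case: unmatched;
  rewrite ?expr1 ?expr0 ?sub0r ?subr0.
Qed.

Lemma balanced_matched a u : balanced a u -> ~~ unmatched a u.
Proof. by rewrite /unmatched => /eqP ->; rewrite addnn odd_double. Qed.

Lemma ip_le a b : (ip a b <= d)%N.
Proof.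
rewrite -[X in (_ <= X)%N]card_ord -sum1_card; apply: leq_sum => j _.
by case: (_ && _).
Qed.

Definition flip_bit (j : 'I_d) u : U :=
  ([ffun k => if k == j then ~~ u.1 k else u.1 k], u.2).

Lemma flip_bitK j : involutive (flip_bit j).
Proof.
move=> [b b']; congr (_, _); apply/ffunP => k; rewrite !ffunE /=.
by case: eqP; rewrite ?negbK.
Qed.

Lemma sgn_flip j a u : sgn a (flip_bit j u) = (-1) ^+ a j * sgn a u.
Proof.
rewrite /sgn /= !exprD mulrA; congr (_ * _).
have ipE b : ip a b = ((a j && b j) + \sum_(k | k != j) (a k && b k))%N.
  by rewrite /ip (bigD1 j).
rewrite !ipE ffunE eqxx !exprD mulrA; congr (_ * (-1) ^+ _); last first.
  by apply: eq_bigr => k kj; rewrite ffunE (negbTE kj).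
by case: (a j); case: (u.1 j); rewrite /= ?expr0 ?expr1 ?mulr1 ?mulN1r ?opprK.
Qed.

Lemma card_U : #|{: U}| = (4 ^ d)%N.
Proof. by rewrite card_prod card_ffun card_bool card_ord -expnMn. Qed.

(** If [a] and [a'] differ at [j], flipping bit [j] of [u.1] is an involution that negates the
    product of the signs. *)
Lemma sgn_orth a a' :
  \sum_u sgn a u * sgn a' u = if a == a' then (4 ^ d)%:R else 0.
Proof.
case: eqP => [<-|/eqP aa'].
  rewrite (eq_bigr (fun=> 1)) => [|u _]; first by rewrite sumr_const card_U.
  by rewrite /sgn -exprMn mulrNN mul1r expr1n.
have [j aj] : exists j, a j != a' j.
  by apply/existsP; apply: contraNT aa'; rewrite negb_exists => /forallP h;
    apply/eqP/ffunP => j; apply/eqP; have := h j; rewrite negbK.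
set S := \sum_u _; have : S = - S.
  rewrite {1}/S (reindex_inj (inv_inj (flip_bitK j))) /= /S -sumrN.
  apply: eq_bigr => u _; rewrite !sgn_flip mulrACA -exprD.
  by move: aj; case: (a j); case: (a' j) => //= _; rewrite ?addn0 ?add0n expr1 mulN1r.
by move=> /eqP; rewrite -addr_eq0 -mulr2n mulrn_eq0 /= => /eqP.
Qed.

(** [ip a] takes at most [d + 1] values; Cauchy-Schwarz on the sizes of its fibres bounds the
    collisions from below. *)
Lemma card_balanced a : (4 ^ d <= d.+1 * #|[pred u : U | balanced a u]|)%N.
Proof.
pose c (k : 'I_d.+1) := #|[pred b : A | ip a b == k]|.
have sumc : (\sum_k c k = 2 ^ d)%N.
  have -> : (2 ^ d)%N = #|{: A}| by rewrite card_ffun card_bool card_ord.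
  rewrite -sum1_card (partition_big (fun b => inord (ip a b) : 'I_d.+1) xpredT) //=.
  apply: eq_bigr => k _; rewrite /c -sum1_card; apply: eq_bigl => b.
  by rewrite !inE -val_eqE /= inordK // ltnS ip_le.
have sumc2 : (\sum_k c k * c k = #|[pred u : U | balanced a u]|)%N.
  rewrite -sum1_card (partition_big (fun u : U => inord (ip a u.1) : 'I_d.+1) xpredT) //=.
  apply: eq_bigr => k _; rewrite /c -cardX -sum1_card; apply: eq_bigl => -[b b'].
  rewrite !inE /balanced /= -val_eqE /= inordK ?ltnS ?ip_le // andbC.
  rewrite ![_ && (ip a b == k)]andbC.
  by case: (ip a b =P k) => [->|//] /=; rewrite eq_sym.
have : (2 * (\sum_k c k) * (\sum_k c k) <= 2 * (d.+1 * \sum_k c k * c k))%N.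
  have -> : (2 * (\sum_k c k) * (\sum_k c k) = \sum_k \sum_l 2 * (c k * c l))%N.
    rewrite -mulnA big_distrlr /= big_distrr; apply: eq_bigr => k _.
    by rewrite big_distrr.
  have -> : (2 * (d.+1 * \sum_k c k * c k) = \sum_k \sum_l (c k * c k + c l * c l))%N.
    under [RHS]eq_bigr => k _ do rewrite big_split sumT_const card_ord /=.
    by rewrite big_split /= sumT_const card_ord -big_distrr /=; lia.
  apply: leq_sum => k _; apply: leq_sum => l _.
  by rewrite !mulnn; case: (nat_Cauchy (c k) (c l)).
rewrite -sumc2 sumc -mulnA leq_mul2l /= -expnMn; exact.
Qed.

(* Lindsey: AM-GM against the orthogonality of the sign vectors. *)
Lemma sgn_discrepancy (h : A -> R) (T : pred U) :
  (forall a, 0 <= h a <= (2 ^ d)%:R^-1) ->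
  \sum_a h a * (\sum_(u | T u) sgn a u) <= (4 ^ d)%:R / (2 ^ d./2)%:R.
Proof.
(* By orthogonality the mean square of [g] is the sum of [h a ^ 2], at most
   [2 ^ d * (2 ^ d)^-2 <= lam ^ 2]. So [lam] is the scale at which AM-GM does the work of
   Cauchy-Schwarz. *)
move=> hb; pose lam : R := (2 ^ d./2)%:R^-1.
have lam0 : 0 < lam by rewrite invr_gt0 ltr0n expn_gt0.
have lam2 : (2 ^ d)%:R^-1 <= lam ^+ 2.
  rewrite /lam exprVn -natrX -expnM lef_pV2 ?posrE ?ltr0n ?expn_gt0 // ler_nat.
  by rewrite leq_exp2l //; have := odd_double_half d; lia.
pose g u := \sum_a h a * sgn a u.
have -> : \sum_a h a * (\sum_(u | T u) sgn a u) = \sum_(u | T u) g u.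
  by rewrite exchange_big /=; apply: eq_bigr => a _; rewrite mulr_sumr.
have gsq : \sum_u g u ^+ 2 = (4 ^ d)%:R * \sum_a h a ^+ 2.
  have -> : \sum_u g u ^+ 2 = \sum_a \sum_a' h a * h a' * \sum_u sgn a u * sgn a' u.
    rewrite exchange_big /= [RHS]exchange_big /=.
    under [RHS]eq_bigr => a _ do (under eq_bigr => a' _ do rewrite mulr_sumr; rewrite exchange_big).
    rewrite exchange_big /=; apply: eq_bigr => u _; rewrite expr2 /g mulr_suml.
    apply: eq_bigr => a _; rewrite mulr_sumr; apply: eq_bigr => a' _.
    by rewrite mulrACA.
  rewrite mulr_sumr; apply: eq_bigr => a _; rewrite (bigD1 a) //= sgn_orth eqxx.
  rewrite big1 ?addr0 => [|a' a'a]; first by rewrite mulrC expr2.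
  by rewrite sgn_orth eq_sym (negbTE a'a) mulr0.
have amgm u : T u -> g u <= lam / 2 + g u ^+ 2 / (2 * lam).
  move=> _; rewrite -subr_ge0.
  have -> : lam / 2 + g u ^+ 2 / (2 * lam) - g u = (lam - g u) ^+ 2 / (2 * lam).
    by field; rewrite lt0r_neq0.
  by rewrite divr_ge0 ?sqr_ge0 // mulr_ge0 // ltW.
apply: le_trans (ler_sum _ amgm) _.
have full : \sum_(u | T u) (lam / 2 + g u ^+ 2 / (2 * lam)) <=
    \sum_u (lam / 2 + g u ^+ 2 / (2 * lam)).
  rewrite [X in _ <= X](bigID T) /= lerDl; apply: sumr_ge0 => u _.
  by rewrite addr_ge0 ?divr_ge0 ?sqr_ge0 ?mulr_ge0 // ltW.
apply: le_trans full _.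
rewrite big_split /= sumr_const card_U -mulr_suml gsq -[_ *+ 4 ^ d]mulr_natl -/lam.
have hsq : \sum_a h a ^+ 2 <= lam ^+ 2.
  apply: (@le_trans _ _ (\sum_(a : A) (2 ^ d)%:R^-1 ^+ 2)).
    by apply: ler_sum => a _; have /andP[h0 h1] := hb a; rewrite lerXn2r // nnegrE invr_ge0 ler0n.
  rewrite sumr_const card_ffun card_bool card_ord.
  have -> : (2 ^ d)%:R^-1 ^+ 2 *+ (2 ^ d) = (2 ^ d)%:R^-1 :> R; last exact: lam2.
  rewrite -[LHS]mulr_natl expr2 mulrA divff ?mul1r //.
have h3 : (4 ^ d)%:R * (\sum_a h a ^+ 2) / (2 * lam) <= (4 ^ d)%:R * (lam / 2).
  rewrite ler_pdivrMr ?mulr_gt0 // -mulrA ler_wpM2l ?ler0n //.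
  by apply: le_trans hsq _; rewrite le_eqVlt; apply/orP; left; apply/eqP; field.
apply: le_trans (lerD (lexx _) h3) _.
by rewrite -mulrDr -splitr.
Qed.

End InnerProduct.

(** * The hard distribution and the corruption bound *)

Section HardDistribution.
Variables (R : realType) (s d : nat).
Local Notation A := {ffun 'I_d -> bool}.
Local Notation U := (A * A)%type.
Local Notation V := {ffun 'I_s -> U}.
Implicit Types (a : A) (u : U) (v : V) (F : A -> V -> R) (Q : A -> V -> U -> R).

Definition nbal a : nat := #|[pred u : U | balanced a u]|.

Definition feasible a v : bool := [forall j, balanced a (v j)].

(* [a] is uniform and, given [a], the entries of [v] are independent and uniform
   among the [u] balanced for [a]. *)
Definition weight a v : R := (feasible a v)%:R * ((2 ^ d * nbal a ^ s)%:R)^-1.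

Definition expect F : R := \sum_a \sum_v weight a v * F a v.

Lemma nbal_gt0 a : (0 < nbal a)%N.
Proof.
have := card_balanced a; rewrite -/(nbal a); case: (nbal a) => //.
by rewrite muln0 leqn0 expn_eq0.
Qed.

Lemma weight_ge0 a v : 0 <= weight a v.
Proof. by rewrite mulr_ge0 ?invr_ge0 ?ler0n. Qed.

Lemma card_feasible a : #|[pred v : V | feasible a v]| = (nbal a ^ s)%N.
Proof.
rewrite /nbal -[X in (_ ^ X)%N]card_ord -card_ffun_on; apply: eq_card => v.
rewrite [LHS]inE; apply/forallP/ffun_onP => h j; have := h j.
all: by rewrite !inE.
Qed.

Lemma sum_weight a : \sum_v weight a v = (2 ^ d)%:R^-1.
Proof.
rewrite -mulr_suml -natr_sum; have -> : (\sum_v feasible a v)%N = (nbal a ^ s)%N.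
  rewrite -card_feasible -sum1_card [RHS]big_mkcond; apply: eq_bigr => v _.
  by rewrite inE; case: feasible.
rewrite natrM invfM mulrCA divff ?mulr1 //.
by rewrite pnatr_eq0 expn_eq0 negb_and -lt0n nbal_gt0.
Qed.

Lemma expect_const (x : R) : expect (fun _ _ => x) = x.
Proof.
rewrite /expect; under eq_bigr => a _ do rewrite -mulr_suml sum_weight.
rewrite sumr_const card_ffun card_bool card_ord -[LHS]mulr_natl mulrA divff ?mul1r //.
Qed.

Lemma expect_le F F' : (forall a v, feasible a v -> F a v <= F' a v) ->
  expect F <= expect F'.
Proof.
move=> FF'; apply: ler_sum => a _; apply: ler_sum => v _.
rewrite /weight; case: (boolP (feasible a v)) => fv; last by rewrite !mul0r.
by rewrite ler_wpM2l ?FF' // mul1r invr_ge0 ler0n.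
Qed.

Lemma expectB F F' : expect (fun a v => F a v - F' a v) = expect F - expect F'.
Proof.
rewrite /expect -sumrB; apply: eq_bigr => a _; rewrite -sumrB.
by apply: eq_bigr => v _; rewrite mulrBr.
Qed.

Lemma expectZ (x : R) F : expect (fun a v => x * F a v) = x * expect F.
Proof.
rewrite /expect mulr_sumr; apply: eq_bigr => a _; rewrite mulr_sumr.
by apply: eq_bigr => v _; rewrite mulrCA.
Qed.

Lemma expect_sum (I : finType) (P : pred I) (F : I -> A -> V -> R) :
  expect (fun a v => \sum_(i | P i) F i a v) = \sum_(i | P i) expect (F i).
Proof.
rewrite /expect [RHS]exchange_big /=; apply: eq_bigr => a _.
rewrite [RHS]exchange_big /=; apply: eq_bigr => v _.
by rewrite mulr_sumr.
Qed.

Definition upd v (i : 'I_s) u : V := [ffun j => if j == i then u else v j].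

Definition resample (i : 'I_s) F : A -> V -> R :=
  fun a v => (nbal a)%:R^-1 * \sum_(u | balanced a u) F a (upd v i u).

(** Exchanging [v i] with the fresh [u] permutes the pairs of a feasible [v] and a balanced [u].
    This isolates the data of one server as an independent variable. *)
Lemma expect_resample i F : expect (resample i F) = expect F.
Proof.
apply: eq_bigr => a _; pose C : R := ((2 ^ d * nbal a ^ s)%:R)^-1.
have wE G : \sum_v weight a v * G v = C * \sum_(v | feasible a v) G v.
  rewrite mulr_sumr [RHS]big_mkcond; apply: eq_bigr => v _.
  by rewrite /weight; case: feasible; rewrite ?mul1r ?mul0r.
rewrite !wE -mulr_sumr; congr (_ * _).
apply: (mulfI (x := (nbal a)%:R)); first by rewrite pnatr_eq0 -lt0n nbal_gt0.
rewrite mulrA divff ?mul1r; last by rewrite pnatr_eq0 -lt0n nbal_gt0.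
pose sw (z : V * U) := (upd z.1 i z.2, z.1 i).
have swK : involutive sw.
  move=> [v u]; rewrite /sw /= !ffunE eqxx; congr (_, _).
  by apply/ffunP => j; rewrite !ffunE; case: eqP => [->|].
have swP z : feasible a (sw z).1 && balanced a (sw z).2 =
    feasible a z.1 && balanced a z.2.
  wlog suff H : z / feasible a z.1 && balanced a z.2 ->
      feasible a (sw z).1 && balanced a (sw z).2.
    by apply/idP/idP => [/H|/H //]; rewrite swK.
  case: z => v u /= /andP[/forallP fv bu]; rewrite fv andbT.
  by apply/forallP => j; rewrite ffunE; case: eqP.
transitivity (\sum_(z : V * U | feasible a z.1 && balanced a z.2) F a (upd z.1 i z.2)).
  by rewrite pair_big.
rewrite (reindex_inj (inv_inj swK)) /= (eq_bigl _ _ swP).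
transitivity (\sum_(z : V * U | feasible a z.1 && balanced a z.2) F a z.1).
  apply: eq_bigr => -[v u] _ /=; congr (F a _); apply/ffunP => j.
  by rewrite !ffunE; case: eqP => [->|].
rewrite -(pair_big (feasible a) (balanced a) (fun v _ => F a v)) /= mulr_sumr.
by apply: eq_bigr => v _; rewrite sumr_const mulr_natl.
Qed.

(** In the application [u] is the data of one server, [(a, v)] stands for all the others, and there
    is one rectangle per coin and content of that server's channel; [N] is then the number of
    contents. *)
Definition rectangular (N : R) Q : Prop :=
  exists (I : finType) (lam : I -> R) (S : I -> A -> V -> bool) (T : I -> U -> bool),
    [/\ forall k, 0 <= lam k, \sum_k lam k <= N &
      forall a v u, Q a v u = \sum_k lam k * (S k a v && T k u)%:R].

(** A product of rectangles is a rectangle. The power is the probability that [t] independent runs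
    all accept. *)
Lemma rectangular_exp N Q t : 0 <= N -> rectangular N Q ->
  rectangular (N ^+ t) (fun a v u => Q a v u ^+ t).
Proof.
move=> N0 rQ; elim: t => [|t [I' [lam' [S' [T' [l0' lN' QE']]]]]].
  exists unit, (fun=> 1), (fun _ _ _ => true), (fun _ _ => true).
  by split=> [k|| a v u]; rewrite ?sumr_const ?card_unit ?expr0 ?mulr1 //= ler01.
have [I [lam [S [T [l0 lN QE]]]]] := rQ.
exists (I * I')%type, (fun k => lam k.1 * lam' k.2).
exists (fun k a v => S k.1 a v && S' k.2 a v), (fun k u => T k.1 u && T' k.2 u).
split=> [k|| a v u]; first by rewrite mulr_ge0.
- rewrite -(pair_bigA _ (fun k k' => lam k * lam' k')) /= exprS.
  under eq_bigr do rewrite -mulr_sumr.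
  rewrite -mulr_suml; apply: ler_pM => //; exact: sumr_ge0.
- rewrite exprS QE' QE mulr_suml -(pair_bigA _ (fun k k' =>
    lam k * lam' k' * (S k a v && S' k' a v && (T k u && T' k' u))%:R)) /=.
  apply: eq_bigr => k _; rewrite mulr_sumr; apply: eq_bigr => k' _.
  by rewrite mulrACA andbACA -natrM mulnb.
Qed.

Lemma rectangular_ge0 N Q a v u : rectangular N Q -> 0 <= Q a v u.
Proof.
case=> I [lam [S [T [l0 _ ->]]]]; apply: sumr_ge0 => k _.
by rewrite mulr_ge0 ?ler0n.
Qed.

(** For a fixed coin and transcript the pasting hypothesis makes the accepted triples a rectangle,
    of weight [1 / #|W|]; the total weight is the number of transcripts. *)
Lemma rectangular_paste (W C : finType) (G : W -> A -> V -> U -> bool)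
    (p : W -> A -> V -> U -> C) :
  (forall w a v u a' v' u', G w a v u' -> G w a' v' u -> p w a v u' = p w a' v' u ->
     G w a v u /\ p w a v u = p w a v u') ->
  (0 < #|W|)%N ->
  rectangular #|C|%:R (fun a v u => #|[pred w | G w a v u]|%:R / #|W|%:R).
Proof.
move=> paste W0; exists (W * C)%type, (fun=> #|W|%:R^-1).
exists (fun z a v => [exists u, G z.1 a v u && (p z.1 a v u == z.2)]).
exists (fun z u => [exists a, exists v, G z.1 a v u && (p z.1 a v u == z.2)]).
have W0' : #|W|%:R != 0 :> R by rewrite pnatr_eq0 -lt0n.
split=> [k||a v u]; first by rewrite invr_ge0 ler0n.
  by rewrite sumr_const card_prod -[X in X <= _]mulr_natr natrM mulrA mulVf ?mul1r.
rewrite -mulr_sumr mulrC; congr (_ * _).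
rewrite -natr_sum -sum1_card; congr _%:R.
rewrite -(pair_bigA _ (fun w c => nat_of_bool ([exists u, G w a v u && (p w a v u == c)] &&
  [exists a, exists v, G w a v u && (p w a v u == c)]))) /= big_mkcond.
apply: eq_bigr => w _; rewrite inE.
have rectE c : [exists u, G w a v u && (p w a v u == c)] &&
    [exists a, exists v, G w a v u && (p w a v u == c)] =
    G w a v u && (p w a v u == c).
  apply/andP/idP => [[/existsP[u' /andP[g /eqP pc]]]|guc].
    case/existsP=> a' /existsP[v' /andP[g' /eqP pc']].
    have [-> ->] := paste _ _ _ _ _ _ _ g g' (etrans pc (esym pc')).
    by rewrite pc eqxx.
  split; first by apply/existsP; exists u.
  by apply/existsP; exists a; apply/existsP; exists v.
under eq_bigr do rewrite rectE.
case: (G w a v u) => /=; last by rewrite big1.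
by rewrite (bigD1 (p w a v u)) //= eqxx big1 // => c; rewrite eq_sym => /negbTE ->.
Qed.

(** The divisor counts all pairs, so that adding the signed mean of [Q] turns the sum over unmatched
    pairs into the sum over the others. *)
Definition expect_unmatched Q : R :=
  expect (fun a v => (4 ^ d)%:R^-1 * \sum_(u | unmatched a u) Q a v u).

Definition expect_balanced Q : R :=
  expect (fun a v => (nbal a)%:R^-1 * \sum_(u | balanced a u) Q a v u).

(** Unmatched plus signed mass is the mass of the remaining pairs; these include the balanced ones,
    whose density is at least [1 / (d + 1)]. The signed mass is bounded rectangle by rectangle with
    [sgn_discrepancy], which applies because the weights given [a] sum to [2 ^ -d]. *)
Lemma rectangular_bound N Q : rectangular N Q ->
  expect_balanced Q <= d.+1%:R * (expect_unmatched Q + N / (2 ^ d./2)%:R).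
Proof.
move=> rQ; have Q0 a v u := rectangular_ge0 a v u rQ.
have D0 : 0 < (4 ^ d)%:R :> R by rewrite ltr0n expn_gt0.
pose E' := expect (fun a v => (4 ^ d)%:R^-1 * \sum_u sgn R a u * Q a v u).
have h1 : expect_balanced Q <= d.+1%:R * (expect_unmatched Q + E').
  rewrite /expect_unmatched /E' mulrDr -!expectZ.
  have -> : forall F F', expect F + expect F' = expect (fun a v => F a v + F' a v).
    by move=> F F'; rewrite /expect -big_split; apply: eq_bigr => a _;
      rewrite -big_split; apply: eq_bigr => v _; rewrite mulrDr.
  apply: expect_le => a v _; rewrite -mulrDr -mulrDr.
  have -> : \sum_(u | unmatched a u) Q a v u + \sum_u sgn R a u * Q a v u =
      \sum_(u | ~~ unmatched a u) Q a v u.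
    rewrite [X in _ + X](bigID (unmatched a)) /= addrA -big_split /= big1 ?add0r.
      by apply: eq_bigr => u um; rewrite sgnE um (negbTE um) subr0 mul1r.
    by move=> u um; rewrite sgnE um sub0r mulN1r addrN.
  have h2 : \sum_(u | balanced a u) Q a v u <= \sum_(u | ~~ unmatched a u) Q a v u.
    rewrite [X in _ <= X](bigID (balanced a)) /=.
    rewrite (eq_bigl (balanced a)) ?lerDl ?sumr_ge0 // => u.
    by case b: (balanced a u); rewrite ?andbF // (balanced_matched b).
  apply: le_trans (ler_wpM2l _ h2) _; first by rewrite invr_ge0 ler0n.
  rewrite mulrA ler_wpM2r ?sumr_ge0 // ler_pdivlMr // mulrC ler_pdivrMr ?ltr0n ?nbal_gt0 //.
  by rewrite -natrM ler_nat card_balanced.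
apply: le_trans h1 _; rewrite ler_wpM2l ?ler0n // lerD2l /E'.
have [I [lam [S [T [l0 lN QE]]]]] := rQ.
have -> : expect (fun a v => (4 ^ d)%:R^-1 * \sum_u sgn R a u * Q a v u) =
    (4 ^ d)%:R^-1 * \sum_k lam k *
      \sum_a (\sum_v weight a v * (S k a v)%:R) * (\sum_(u | T k u) sgn R a u).
  rewrite expectZ; congr (_ * _); rewrite /expect.
  under [RHS]eq_bigr => k _ do rewrite mulr_sumr.
  rewrite [RHS]exchange_big /=; apply: eq_bigr => a _.
  under [RHS]eq_bigr => k _ do rewrite mulr_suml mulr_sumr.
  rewrite [RHS]exchange_big /=; apply: eq_bigr => v _.
  rewrite [LHS]mulr_sumr; under [LHS]eq_bigr => u _ do rewrite QE mulr_sumr mulr_sumr.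
  rewrite exchange_big /=; apply: eq_bigr => k _.
  rewrite [X in _ = _ * (_ * X)]big_mkcond !mulr_sumr; apply: eq_bigr => u _.
  case: (S k a v); case: (T k u) => /=; rewrite ?mulr0 ?mulr1 ?mul0r ?mulr0 //.
  by rewrite mulrCA mulrA [lam k * _]mulrC -mulrA mulrCA; ring.
rewrite mulrC ler_pdivrMr // mulrAC -mulrA.
have h3 k : lam k * (\sum_a (\sum_v weight a v * (S k a v)%:R) *
    (\sum_(u | T k u) sgn R a u)) <= lam k * ((4 ^ d)%:R / (2 ^ d./2)%:R).
  rewrite ler_wpM2l //; apply: sgn_discrepancy => a; apply/andP; split.
    by apply: sumr_ge0 => v _; rewrite mulr_ge0 ?weight_ge0 ?ler0n.
  rewrite -(sum_weight a); apply: ler_sum => v _.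
  by rewrite -[X in _ <= X]mulr1 ler_wpM2l ?weight_ge0 // lern1; case: (S k a v).
apply: le_trans (ler_sum _ (fun k _ => h3 k)) _.
rewrite -mulr_suml ler_wpM2r // divr_ge0 ?ler0n //.
Qed.

(** The tangent at [b] of a convex power; averaged, it yields the needed case of Jensen's
    inequality. *)
Lemma power_tangent (x b : R) t : 0 <= x -> 0 <= b ->
  b ^+ t.+1 + t.+1%:R * b ^+ t * (x - b) <= x ^+ t.+1.
Proof.
move=> x0 b0; elim: t => [|t IH]; first by rewrite expr0 mulr1 mul1r !expr1 addrC subrK.
rewrite [x ^+ _]exprS; apply: le_trans (ler_wpM2l x0 IH).
rewrite -subr_ge0.
have -> : x * (b ^+ t.+1 + t.+1%:R * b ^+ t * (x - b)) -
    (b ^+ t.+2 + t.+2%:R * b ^+ t.+1 * (x - b)) = t.+1%:R * b ^+ t * (x - b) ^+ 2.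
  by rewrite !exprS -[t.+2]addn1 natrD; ring.
by rewrite mulr_ge0 ?sqr_ge0 // mulr_ge0 ?ler0n ?exprn_ge0.
Qed.

(** [rectangular_bound] for a power of [Q]: convexity keeps the balanced side above [b ^ t.+1],
    while the unmatched side drops to [e ^ t.+1], small enough to beat the factor [d + 1]. *)
Lemma corruption_bound N Q (b e : R) t : 0 <= b -> 0 <= e -> 0 <= N -> rectangular N Q ->
  b <= expect_balanced Q ->
  (forall a v u, feasible a v -> unmatched a u -> Q a v u <= e) ->
  b ^+ t.+1 <= d.+1%:R * (e ^+ t.+1 + N ^+ t.+1 / (2 ^ d./2)%:R).
Proof.
move=> b0 e0 N0 rQ bQ Qe.
have Q0 a v u := rectangular_ge0 a v u rQ.
apply: (@le_trans _ _ (expect_balanced (fun a v u => Q a v u ^+ t.+1))).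
  pose Q1 a v u := b ^+ t.+1 + t.+1%:R * b ^+ t * (Q a v u - b).
  apply: (@le_trans _ _ (expect_balanced Q1)); last first.
    apply: expect_le => a v _; rewrite ler_wpM2l ?invr_ge0 ?ler0n //.
    by apply: ler_sum => u _; apply: power_tangent.
  have -> : expect_balanced Q1 = b ^+ t.+1 + t.+1%:R * b ^+ t * (expect_balanced Q - b).
    have -> : expect_balanced Q - b = expect (fun a v =>
        (nbal a)%:R^-1 * (\sum_(u | balanced a u) Q a v u) - b).
      by rewrite expectB expect_const.
    rewrite -expectZ -[X in _ = X + _](expect_const (b ^+ t.+1)).
    have -> : forall F F', expect F + expect F' = expect (fun a v => F a v + F' a v).
      by move=> F F'; rewrite /expect -big_split; apply: eq_bigr => a _;
        rewrite -big_split; apply: eq_bigr => v _; rewrite mulrDr.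
    rewrite /expect_balanced; congr expect; apply/funext => a; apply/funext => v.
    have nb : (nbal a)%:R != 0 :> R by rewrite pnatr_eq0 -lt0n nbal_gt0.
    have sc (x : R) : \sum_(u | balanced a u) x = (nbal a)%:R * x.
      by rewrite sumr_const mulr_natl.
    rewrite big_split /= -mulr_sumr sumrB !sc mulrDr mulrA mulVf // mul1r.
    by rewrite mulrCA mulrBr mulrA mulVf // mul1r.
  by rewrite lerDl mulr_ge0 ?subr_ge0 // mulr_ge0 ?ler0n ?exprn_ge0.
apply: le_trans (rectangular_bound (rectangular_exp t.+1 N0 rQ)) _.
rewrite ler_wpM2l ?ler0n // lerD2r -[X in _ <= X]expect_const; apply: expect_le => a v fv.
rewrite mulrC ler_pdivrMr ?ltr0n ?expn_gt0 //.
apply: (@le_trans _ _ (\sum_(u | unmatched a u) e ^+ t.+1)).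
  by apply: ler_sum => u um; rewrite lerXn2r ?nnegrE // Qe.
rewrite sumr_const -[X in X <= _]mulr_natr ler_wpM2l ?exprn_ge0 // ler_nat.
by rewrite -card_U; apply: max_card.
Qed.

End HardDistribution.

(** * From protocols to rectangles *)

Section StarInstance.
Variables (R : realType) (s n d L : nat).
Hypotheses (s2 : (2 <= s)%N) (d0 : (0 < d)%N) (sdn : ((s + d).-1 <= n)%N).
Local Notation A := {ffun 'I_d -> bool}.
Local Notation U := (A * A)%type.
Local Notation V := {ffun 'I_s -> U}.
Implicit Types (a : A) (u : U) (v : V).

Definition center : 'I_s := Ordinal (ltnW s2).

Definition bit_row a (t : 'I_d) : 'rV[int]_(d + 1) :=
  row_mx (delta_mx 0 t) (const_mx (a t)%:Z).

Definition check_row u : 'rV[int]_(d + 1) :=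
  row_mx (\row_t ((u.1 t)%:Z - (u.2 t)%:Z)) 0.

(** The centre is server 0 with rows [0] to [d - 1]; row [d + i - 1] is the check of server
    [i >= 1]. Hence the shift [(j - d).+1] and the row count [(s + d).-1]. *)
Definition star a v : linsys s n d :=
  linsys_of
    (fun j : 'I_n =>
      if insub (j : nat) is Some t then bit_row a t
      else if insub (j - d).+1 is Some i then check_row (v i) else 0)
    (fun j => if (j < d)%N then center
              else if insub (j - d).+1 is Some i then i else center).

Lemma solves_bit_row (x : 'cV[R]_d) a t :
  solves x (bit_row a t) <-> x t 0 = (a t)%:R.
Proof.
rewrite solvesE row_mxEr mxE -pmulrn (bigD1 t) //= big1 ?addr0 => [|j jt].
  by rewrite row_mxEl mxE !eqxx mul1r.
by rewrite row_mxEl mxE (negbTE jt) andbF mul0r.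
Qed.

Lemma solves_check_row (x : 'cV[R]_d) a u : (forall t, x t 0 = (a t)%:R) ->
  solves x (check_row u) <-> balanced a u.
Proof.
move=> xa; rewrite solvesE row_mxEr mxE.
have -> : \sum_(j < d) (check_row u 0 (lshift 1 j))%:~R * x j 0 =
    (ip a u.1)%:R - (ip a u.2)%:R.
  rewrite /ip !natr_sum -sumrB; apply: eq_bigr => j _.
  rewrite row_mxEl mxE rmorphB /= mulrBl xa -!pmulrn.
  by case: (a j); case: (u.1 j); case: (u.2 j); rewrite /= ?mulr1 ?mulr0.
rewrite /balanced -(eqr_nat R) -subr_eq0; split=> [->|/eqP //].
by rewrite eqxx.
Qed.

Lemma solution_star (x : 'cV[R]_d) a v : solution (star a v) x <->
  (forall t, x t 0 = (a t)%:R) /\ (forall i, i != center -> balanced a (v i)).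
Proof.
rewrite solution_linsys_of; split=> [h|[ha hv] j].
  have xa t : x t 0 = (a t)%:R.
    have tn : (t < n)%N.
      by apply: leq_trans (ltn_ord t) _; move: s2 sdn; lia.
    by have := h (Ordinal tn); rewrite /= valK => /solves_bit_row.
  split=> // i i0; have ival : (0 < i)%N.
    by move: i0; rewrite -val_eqE /= lt0n.
  have ltn' : (d + i.-1 < n)%N by apply: leq_trans sdn; have := ltn_ord i; lia.
  have := h (Ordinal ltn'); rewrite /= insubF; last by rewrite ltnNge leq_addr.
  rewrite addKn prednK // valK.
  by move=> /(solves_check_row _ xa).
case: insubP => [t _ _|_]; first by apply/solves_bit_row.
case: insubP => [i _ ie|_]; last exact: solves0.
by apply/(solves_check_row _ ha)/hv; apply: contra_eq_neq ie => ->.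
Qed.

Lemma star_bounded a v : entries_bounded L (star a v).
Proof.
apply: bounded_linsys_of => j k.
have L0 : (0 < 2 ^ L)%N by rewrite expn_gt0.
case: insub => [t|]; last case: insub => [i|]; last by rewrite mxE normr0 exprn_ge0.
- by have [k' ->|k' ->] := split_ordP k; rewrite ?row_mxEl ?row_mxEr mxE powZE;
    [case: (_ && _) | case: (a t)]; lia.
- have [k' ->|k' ->] := split_ordP k; rewrite ?row_mxEl ?row_mxEr mxE powZE ?normr0 //.
  by case: ((v i).1 k'); case: ((v i).2 k'); lia.
Qed.

Lemma held_leaf a a' v v' i : i != center -> v i = v' i ->
  held (star a v) i = held (star a' v') i.
Proof.
move=> i0 vi; apply: held_ext => // j; rewrite !inrow_linsys_of /=.
case: ltnP => jd; first by move=> e; rewrite -e eqxx in i0.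
have -> : insub (j : nat) = None :> option 'I_d by rewrite insubF // ltnNge jd.
by case: insub => [i' ->|//]; rewrite vi.
Qed.

Lemma held_center a v v' : held (star a v) center = held (star a v') center.
Proof.
apply: held_ext => // j; rewrite !inrow_linsys_of /=.
case: ltnP => jd; first by rewrite insubT.
have -> : insub (j : nat) = None :> option 'I_d by rewrite insubF // ltnNge jd.
case: insubP => [i _ ie|//] ic; by rewrite ic in ie.
Qed.

(** For a server [i] with a cheap channel, let [Q] be the probability of accepting with at most [l]
    bits on that channel. It is a mixture of rectangles of total weight [5 ^ l], at least 89/100 on
    average over balanced [u] and at most 1/100 on unmatched ones; the corruption bound at power
    [t.+1] then limits [d]. *)
Lemma public_coordinator_bound c t l :
  randomly_solvable R public_coins coordinator_model s n d L c ->
  (d < 2 ^ t.+1)%N -> (10 * c <= s.-1 * l.+1)%N ->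
  (d./2 <= 1 + 2 * t.+1 + 3 * (l * t.+1))%N.
Proof.
case=> W [P HP] dt cl.
pose tr w a v := coord_trace (P w) (held (star a v)) c [::].
have trE w a v : exists H o, tr w a v = Some (H, o).
  have [h _] := HP _ (star_bounded a v); have := h w; rewrite /= run_trace.
  by rewrite -/(tr w a v); case: (tr w a v) => [[H o]|] //; exists H, o.
pose hist w a v := if tr w a v is Some (H, _) then H else [::].
pose acc w a v := if tr w a v is Some (_, Some _) then true else false.
have sucE w a v : succeeds (R := R) (star a v) (run (m := coordinator_model) (P w) tt (held (star a v)) c) ->
    acc w a v <-> exists x : 'cV[R]_d, solution (star a v) x.
  case=> o; rewrite /= run_trace /acc -/(tr w a v); have [H [ o' ->]] := trE w a v.
  by case=> ->; case: o => [x|] /= h; split=> //; exists x.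
have HP1 a v : (0 < #|W|)%N /\ (99 * #|W| <= 100 * #|[pred w | `[< succeeds (R := R) (star a v)
    (run (m := coordinator_model) (P w) tt (held (star a v)) c) >]]|)%N.
  by apply: (@proba_card R); have [] := HP _ (star_bounded a v).
have W0 : (0 < #|W|)%N := (HP1 [ffun=> false] [ffun=> ([ffun=> false], [ffun=> false])]).1.
have W0' : 0 < #|W|%:R :> R by rewrite ltr0n.
have accept a v : feasible a v -> (99 * #|W| <= 100 * #|[pred w | acc w a v]|)%N.
  move=> /forallP fv; apply: leq_trans (HP1 a v).2 _; rewrite leq_mul2l /=.
  apply/subset_leq_card/fintype.subsetP => w; rewrite unfold_in => /asboolP/sucE accE.
  rewrite unfold_in /=; apply/accE; exists (\col_t (a t)%:R); apply/solution_star.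
  by split=> [t'|i _]; [rewrite mxE | apply: fv].
have reject a v i u : i != center -> unmatched a u ->
    (100 * #|[pred w | acc w a (upd v i u)]| <= #|W|)%N.
  move=> i0 un; have := (HP1 a (upd v i u)).2; set S := [pred w | `[< _ >]].
  have : (#|[pred w | acc w a (upd v i u)]| <= #|[predC S]|)%N.
    apply/subset_leq_card/fintype.subsetP => w; rewrite !unfold_in /= => aw.
    apply/negP => /asboolP/sucE accE; have [x /solution_star[_ /(_ i i0)]] := accE.1 aw.
    by rewrite ffunE eqxx => /balanced_matched; rewrite un.
  have := cardC S; rewrite -[#|[predC S]|]/(#|predC S|).
  move: #|[pred w | acc w a (upd v i u)]| #|S| #|predC S| #|W| => x1 x2 x3 x4; lia.
pose len i a v : R := \sum_w (size (channel i (hist w a v)))%:R / #|W|%:R.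
have len0 i a v : 0 <= len i a v.
  by apply: sumr_ge0 => w _; rewrite divr_ge0 ?ler0n.
(* All channels together carry at most [c] bits, so the cheapest of the [s - 1] leaves carries at
   most [c / (s - 1)] on average over feasible inputs. *)
have [i i0 leni] : exists2 i, i != center & s.-1%:R * expect (len i) <= c%:R.
  have i1 : Ordinal s2 != center by [].
  case: (@arg_minP _ _ _ (Ordinal s2) (fun i => i != center) (fun i => expect (len i)) i1).
  move=> i i0 imin; exists i => //.
  apply: (@le_trans _ _ (\sum_(j | j != center) expect (len j))).
    apply: (@le_trans _ _ (\sum_(j : 'I_s | j != center) expect (len i))).
      rewrite sumr_const (_ : #|_| = s.-1) ?mulr_natl //.
      by have := cardC1 center; rewrite card_ord => <-; apply: eq_card => j; rewrite !inE.
    by apply: ler_sum => j; apply: imin.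
  rewrite -expect_sum -[X in _ <= X](expect_const s d); apply: expect_le => a v _.
  rewrite exchange_big /=.
  apply: (@le_trans _ _ (\sum_(w : W) c%:R / #|W|%:R)); last first.
    by rewrite sumr_const -[X in X <= _]mulr_natr mulfVK ?lt0r_neq0.
  apply: ler_sum => w _; rewrite -mulr_suml ler_wpM2r ?invr_ge0 ?ler0n //.
  rewrite -natr_sum ler_nat.
  have [H [ o e]] := trE w a v; have := trace_size e; rewrite /hist e; apply: leq_trans.
  by rewrite [X in (_ <= X)%N](bigID (fun j => j != center)) /= leq_addr.
pose G0 w a v := acc w a v && (size (channel i (hist w a v)) <= l)%N.
pose Q0 a v : R := #|[pred w | G0 w a v]|%:R / #|W|%:R.
pose Q a v u := Q0 a (upd v i u).
pose p w a v u := pad l (map code_dir (channel i (hist w a (upd v i u)))).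
have paste w a v u a' v' u' : G0 w a (upd v i u') -> G0 w a' (upd v' i u) ->
    p w a v u' = p w a' v' u ->
    G0 w a (upd v i u) /\ p w a v u = p w a v u'.
  move=> /andP[g1 l1] /andP[g2 l2] /pad_inj pe.
  have {}pe : channel i (hist w a (upd v i u')) = channel i (hist w a' (upd v' i u)).
    by apply: (inj_map code_dir_inj); apply: pe; rewrite size_map.
  have [H [ o e]] := trE w a (upd v i u'); have [H' [ o' e']] := trE w a' (upd v' i u).
  have HH' : channel i H = channel i H' by move: pe; rewrite /hist e e'.
  (* The second run vouches for [u] on channel [i]; every other server holds the same rows as in the
     first run. *)
  have e2 : tr w a (upd v i u) = Some (H, o).
    apply: (trace_paste e) => j; case: (eqVneq j i) => [->|ji].
      rewrite HH' (@held_leaf a a' (upd v i u) (upd v' i u) i i0); last by rewrite !ffunE eqxx.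
      exact: (trace_consistent e').
    have -> : held (star a (upd v i u)) j = held (star a (upd v i u')) j.
      case: (eqVneq j center) => [->|j0]; first exact: held_center.
      by apply: held_leaf => //; rewrite !ffunE (negbTE ji).
    exact: (trace_consistent e).
  move: g1 l1; rewrite /G0 /p /acc /hist e e2 => -> ->.
  by split.
have rectQ : rectangular #|{: l.-tuple (option (bool * bool))}|%:R Q.
  exact: (@rectangular_paste R s d W _ (fun w a v u => G0 w a (upd v i u)) p paste W0).
(* From 99/100, Markov's inequality removes at most 1/10 for channels longer than [l], by
   [10 * c <= s.-1 * l.+1]. *)
have balQ : 89%:R / 100%:R <= expect_balanced Q.
  rewrite -[expect_balanced Q]/(expect (resample i Q0)) expect_resample.
  pose Acc a v : R := #|[pred w | acc w a v]|%:R / #|W|%:R.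
  apply: (@le_trans _ _ (expect (fun a v => Acc a v - len i a v / l.+1%:R))).
    rewrite expectB.
    have h1 : 99%:R / 100%:R <= expect Acc.
      rewrite -[X in X <= _](expect_const s d); apply: expect_le => a v /accept h.
      rewrite /Acc ler_pdivlMr // mulrAC ler_pdivrMr ?ltr0n //.
      by rewrite -!natrM ler_nat [X in (_ <= X)%N]mulnC.
    have h2 : expect (fun a v => len i a v / l.+1%:R) <= 10%:R^-1.
      have -> : expect (fun a v => len i a v / l.+1%:R) = l.+1%:R^-1 * expect (len i).
        by rewrite -expectZ; congr expect; apply/funext => a; apply/funext => v; rewrite mulrC.
      have s1 : 0 < s.-1%:R :> R by rewrite ltr0n; lia.
      have l1 : 0 < l.+1%:R :> R by rewrite ltr0n.
      have h3 : 10%:R * c%:R <= s.-1%:R * l.+1%:R :> R by rewrite -!natrM ler_nat.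
      rewrite mulrC ler_pdivrMr // -(ler_pM2l s1); apply: le_trans leni _.
      rewrite mulrCA mulrC ler_pdivlMr // mulrC; apply: le_trans h3 _; by [].
    by apply: le_trans (lerB h1 h2); lra.
  apply: expect_le => a v _.
  rewrite /Acc /Q0 /len -mulr_suml mulrAC -mulrBl ler_wpM2r ?invr_ge0 ?ler0n //.
  rewrite lerBlDr.
  have : (#|[pred w | acc w a v]| * l.+1 <=
      #|[pred w | G0 w a v]| * l.+1 + \sum_w size (channel i (hist w a v)))%N.
    rewrite -!sum1_card !big_distrl [X in (X <= _)%N]big_mkcond /=.
    rewrite [X in (_ <= X + _)%N]big_mkcond -big_split /=; apply: leq_sum => w _.
    rewrite !inE /G0; case: (acc w a v) => //=; case: (leqP (size (channel i (hist w a v))) l) => /= hl; lia.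
  rewrite -(ler_nat R) natrM natrD natrM natr_sum => h.
  have l1 : 0 < l.+1%:R :> R by rewrite ltr0n.
  by rewrite -(ler_pM2r l1) mulrDl divfK ?lt0r_neq0.
have unmQ a v u : feasible a v -> unmatched a u -> Q a v u <= 100%:R^-1.
  move=> _ un; rewrite /Q /Q0 ler_pdivrMr // mulrC ler_pdivlMr ?ltr0n // -natrM ler_nat mulnC.
  apply: leq_trans (reject a v i u i0 un); rewrite leq_mul2l /=.
  apply/subset_leq_card/fintype.subsetP => w; rewrite !unfold_in /=.
  by move=> /andP[].
have := corruption_bound t _ _ _ rectQ balQ unmQ.
rewrite divr_ge0 ?ler0n // invr_ge0 !ler0n => /(_ isT isT isT).
rewrite card_pad card_prod card_bool -[(2 * 2).+1%N]/5%N.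
set T := t.+1; set h := d./2 => key.
have nat_key : (89 ^ T * 2 ^ h <= d.+1 * (2 ^ h + 5 ^ (l * T) * 100 ^ T))%N.
  rewrite -(ler_nat R) !natrM natrD natrM !natrX mulrC.
  have H0 : (2 ^+ h : R) != 0 by rewrite expf_neq0 // pnatr_eq0.
  have C0 : (100 ^+ T : R) != 0 by rewrite expf_neq0 // pnatr_eq0.
  have pos : 0 < 100 ^+ T * 2 ^+ h :> R by rewrite mulr_gt0 ?exprn_gt0.
  have {key} := ler_wpM2r (ltW pos) key; rewrite !natrX expr_div_n exprVn -exprM.
  have -> : 89%:R ^+ T / 100%:R ^+ T * (100 ^+ T * 2 ^+ h) = 2 ^+ h * 89 ^+ T :> R by field.
  have -> // : d.+1%:R * (100%:R ^- T + 5%:R ^+ (l * T) / 2 ^+ h) * (100 ^+ T * 2 ^+ h) =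
    d.+1%:R * (2 ^+ h + 5 ^+ (l * T) * 100 ^+ T) :> R.
  by field; rewrite H0.
(* With [d + 1 <= 2 ^ T], this lets half of the left side of [nat_key] absorb the first term on the
   right. The bounds [100 <= 2 * 89] and [5 <= 8] then turn the rest into powers of 2. *)
have T2 : (2 * 2 ^ T <= 89 ^ T)%N.
  apply: (@leq_trans (4 ^ T)%N); last exact: leq_exp_base.
  by rewrite -expnS -[4%N]/(2 ^ 2)%N -expnM leq_exp2l // /T; lia.
have T3 : (100 ^ T <= 2 ^ T * 89 ^ T)%N by rewrite -(expnMn 2 89); apply: leq_exp_base.
have T4 : (5 ^ (l * T) <= 2 ^ (3 * (l * T)))%N by rewrite (expnM 2 3); apply: leq_exp_base.
rewrite -(leq_exp2l (m := 2)) // [X in (_ <= X)%N]expnD [(2 ^ (1 + _))%N]expnD expn1.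
have E89 : (0 < 89 ^ T)%N by rewrite expn_gt0.
have h1 : (89 ^ T * 2 ^ h <= 2 * (2 ^ T * (5 ^ (l * T) * 100 ^ T)))%N.
  have : (d.+1 * 2 ^ h * 2 <= 89 ^ T * 2 ^ h)%N.
    rewrite mulnAC leq_mul2r; apply/orP; right; apply: leq_trans T2.
    by rewrite mulnC leq_mul2l.
  have : (d.+1 * (5 ^ (l * T) * 100 ^ T) <= 2 ^ T * (5 ^ (l * T) * 100 ^ T))%N.
    by rewrite leq_mul2r dt orbT.
  by move: nat_key; rewrite mulnDr; lia.
rewrite -(leq_pmul2l E89); apply: leq_trans h1 _.
have h2 : (5 ^ (l * T) * 100 ^ T <= 2 ^ (3 * (l * T)) * (2 ^ T * 89 ^ T))%N by apply: leq_mul.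
apply: (@leq_trans (2 * (2 ^ T * (2 ^ (3 * (l * T)) * (2 ^ T * 89 ^ T))))%N).
  by rewrite !leq_mul2l h2 !orbT.
have -> : (2 ^ (2 * T) = 2 ^ T * 2 ^ T)%N by rewrite -expnD addnn mul2n.
move: (2 ^ T)%N (89 ^ T)%N (2 ^ (3 * (l * T)))%N => x y z.
by rewrite (_ : (y * _ = 2 * (x * (z * (x * y))))%N) //; lia.
Qed.

End StarInstance.

(** * Asymptotics *)

Section Asymptotics.
Variable R : realType.

Lemma ln2_ge : 2^-1 <= ln 2 :> R.
Proof.
have h : ln (1 + - 2^-1) <= - 2^-1 :> R by apply: le_ln1Dx; lra.
have e : 1 + - 2^-1 = 2^-1 :> R by lra.
by move: h; rewrite e lnV ?posrE // lerN2.
Qed.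

Lemma exp2_le_ln e N : (2 ^ e <= N)%N -> e%:R <= 2 * ln (N%:R : R).
Proof.
move=> eN; have N0 : (0 < N)%N by apply: leq_trans eN; rewrite expn_gt0.
have h : ln ((2 ^ e)%:R : R) <= ln N%:R.
  by rewrite ler_ln ?posrE ?ltr0n ?expn_gt0 // ler_nat.
rewrite natrX lnXn // -[X in X <= _]mulr_natl in h.
have : e%:R * 2^-1 <= e%:R * ln 2 :> R by rewrite ler_wpM2l ?ler0n ?ln2_ge.
by lra.
Qed.

(** An even split of the unknowns of the block system, so that its [(k + 1) (m + 1)] digits number
    at least [d ^ 2 / 4]. *)
Lemma halve d : (0 < d)%N -> exists m k, d = (m + k).+1 /\ (d ^ 2 <= 4 * (k.+1 * m.+1))%N.
Proof.
case: d => // d _; exists d.+1./2, (d - d.+1./2)%N.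
have h := odd_double_half d.+1; split; first by move: h; lia.
move: h; move: d.+1./2 (odd d.+1) => m b h.
have [b0|b1] : b = false \/ b = true by case: b {h}; [right|left].
  have -> : d.+1 = (2 * m)%N by move: h; rewrite b0; lia.
  have -> : (d - m).+1 = m by move: h; rewrite b0; lia.
  rewrite expnMn; lia.
have -> : d.+1 = (2 * m).+1 by move: h; rewrite b1; lia.
have -> : (d - m).+1 = m.+1 by move: h; rewrite b1; lia.
by rewrite -[(2 * m).+1]addn1 sqrnD expnMn; lia.
Qed.

Lemma board_lower_bound s n d L c : (2 <= s)%N -> (0 < d)%N -> (0 < L)%N ->
  (rows_one_server s d <= n)%N ->
  randomly_solvable R public_coins blackboard_model s n d L c ->
  (d ^ 2 * L + s <= 14 * c)%N.
Proof.
rewrite /rows_one_server => s2 d0 L0 hn H.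
have sn : (s <= n)%N by lia.
have := public_board_speaking_bound s2 d0 sn H.
have [m [k [dE dmk]]] := halve d0.
have s0 : (0 < s)%N by lia.
have dn : (d <= n)%N by lia.
move: H dn; rewrite [in randomly_solvable _ _ _ _ _ _ _ _]dE [in (d <= n)%N]dE => H dn.
have := public_board_output_bound s0 dn H.
have : (L * d ^ 2 <= L * (4 * (k.+1 * m.+1)))%N by rewrite leq_mul2l dmk orbT.
lia.
Qed.

Lemma coordinator_lower_bound s n d L c : (2 <= s)%N -> (0 < n)%N -> (0 < d)%N ->
  (0 < L)%N -> (rows_one_server s d <= n)%N ->
  randomly_solvable R public_coins coordinator_model s n d L c ->
  (d ^ 2 * L + s * d)%:R <= 324%:R * c%:R * ln ((s * n * d * L)%:R : R).
Proof.
move=> s2 n0 d0 L0 hn H.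
have hb := board_lower_bound s2 d0 L0 hn (blackboard_of_coordinator H).
(* The power [t.+1] is just large enough to outweigh [d + 1]; it is the logarithm lost in this
   bound. *)
pose t := trunc_log 2 d; pose l := (10 * c %/ s.-1)%N.
have dt : (d < 2 ^ t.+1)%N by apply: trunc_log_ltn.
have s1 : (0 < s.-1)%N by lia.
have cl : (10 * c <= s.-1 * l.+1)%N by rewrite [X in (_ <= X)%N]mulnC ltnW // ltn_ceil.
have lc : (l * s.-1 <= 10 * c)%N by apply: leq_trunc_div.
have hd := public_coordinator_bound s2 d0 hn H dt cl.
have dle : (d <= 3 + 4 * t.+1 + 6 * (l * t.+1))%N by have := odd_double_half d; lia.
(* After multiplication by [s.-1], [l * s.-1 <= 10 * c] and [s <= 2 * c] give
   [s * d <= 2 * (14 + 60) * c * t.+1]; the term [d ^ 2 * L] adds 14. *)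
have key : (d ^ 2 * L + s * d <= 162 * c * t.+1)%N.
  have h1 : (s * d <= 2 * (s.-1 * d))%N by rewrite mulnA leq_mul2r; lia.
  have h2 : (s.-1 * d <= s.-1 * (3 + 4 * t.+1) + 6 * (10 * c * t.+1))%N.
    apply: (@leq_trans (s.-1 * (3 + 4 * t.+1 + 6 * (l * t.+1)))%N).
      by rewrite leq_mul2l dle orbT.
    rewrite mulnDr leq_add2l [(s.-1 * _)%N]mulnCA leq_mul2l /= mulnA leq_mul2r.
    by rewrite [(s.-1 * l)%N]mulnC lc orbT.
  have sc : (s <= 2 * c)%N.
    have [m [k [dE dmk]]] := halve d0; have sn : (s <= n)%N by move: hn; rewrite /rows_one_server; lia.
    have := public_board_speaking_bound s2 d0 sn (blackboard_of_coordinator H); lia.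
  have h3 : (s.-1 * (3 + 4 * t.+1) <= 2 * c * (7 * t.+1))%N by apply: leq_mul; lia.
  have h4 : (d ^ 2 * L <= 14 * c * t.+1)%N.
    by apply: (@leq_trans (14 * c)%N); [lia|rewrite -[X in (X <= _)%N]muln1 leq_mul2l orbT].
  lia.
have tl : t.+1%:R <= 2 * ln ((s * n * d * L)%:R : R).
  apply: exp2_le_ln; rewrite expnS; have := trunc_logP (isT : (1 < 2)%N) d0; rewrite -/t => h.
  apply: (@leq_trans (2 * d)%N); first by rewrite leq_mul2l h.
  have h5 : (s <= s * n)%N by rewrite leq_pmulr.
  apply: (@leq_trans (s * n * d)%N); last by rewrite leq_pmulr.
  by rewrite leq_mul2r (leq_trans s2 h5) orbT.
apply: (@le_trans _ _ (162 * c * t.+1)%:R); first by rewrite ler_nat.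
rewrite !natrM.
have c0 : 0 <= c%:R :> R by rewrite ler0n.
apply: (@le_trans _ _ (162%:R * c%:R * (2 * ln ((s * n * d * L)%:R : R)))).
  by rewrite ler_wpM2l // mulr_ge0.
by rewrite le_eqVlt; apply/orP; left; apply/eqP; rewrite -!natrM; ring.
Qed.

Lemma coordinator_upper_bound s n d L : (2 <= s)%N -> (0 < n)%N -> (0 < d)%N ->
  (0 < L)%N ->
  exists2 c, randomly_solvable R private_coins coordinator_model s n d L c &
    c%:R <= 388%:R * (d ^ 2 * L + s * d)%:R * ln ((s * n * d * L)%:R : R).
Proof.
(* The required [200 * w * (w + L + 1)] is at most [1600 * 4 ^ e], and [1600 <= 2 ^ 12]. *)
move=> s2 n0 d0 L0; pose e := (trunc_log 2 (d * L)).+1; pose q := (2 * e + 12)%N.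
have dL0 : (0 < d * L)%N by rewrite muln_gt0 d0.
have dLe : (d * L < 2 ^ e)%N by apply: trunc_log_ltn.
have q2 : (2 < q)%N by rewrite /q; lia.
have hq : (200 * (d + 1) * (d + 1 + L + 1) <= 2 ^ q)%N.
  have h1 : (d + 1 <= 2 * (d * L))%N by nia.
  have h2 : (d + 1 + L + 1 <= 4 * (d * L))%N by nia.
  have h3 : (200 * (d + 1) * (d + 1 + L + 1) <= 200 * (2 * 2 ^ e) * (4 * 2 ^ e))%N.
    by apply: leq_mul; [apply: leq_mul|]; lia.
  apply: leq_trans h3 _; rewrite /q expnD (mulnC 2 e) expnM -mulnn -[(2 ^ 12)%N]/4096%N.
  by move: (2 ^ e)%N => x; lia.
pose Q0 := ((d + 1).+1 * q.*2.+2).+1.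
pose c := ((d + 1) * (Q0 + (d + 1) * (L + 2)) + s * Q0)%N.
exists c; first exact: randomized_coordinator_protocol.
have cle : (c <= 194 * (d ^ 2 * L + s * d) * e)%N.
  (* Here [d + 2 <= 3d] and [2q + 2 = 4e + 26 <= 30e]; the flag adds 1. *)
  have Qle : (Q0 <= 91 * d * e)%N.
    rewrite /Q0.
    have h1 : ((d + 1).+1 * q.*2.+2 <= (3 * d) * (30 * e))%N by apply: leq_mul; rewrite /q; lia.
    have h2 : (1 <= d * e)%N by rewrite muln_gt0 d0.
    lia.
  rewrite /c; clear c; move: Q0 Qle => Q Qle.
  have h1 : ((d + 1) * (Q + (d + 1) * (L + 2)) <= (2 * d) * (91 * d * e + (2 * d) * (3 * L)))%N.
    by apply: leq_mul; [lia|apply: leq_add => //; apply: leq_mul; lia].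
  have h2 : (s * Q <= s * (91 * d * e))%N by rewrite leq_mul2l Qle orbT.
  have h3 : (d * d * L <= d * d * L * e)%N by rewrite leq_pmulr.
  have h4 : (d * d * e <= d * d * L * e)%N by rewrite leq_mul2r leq_pmulr // orbT.
  have h5 : (0 <= s * d * e)%N by [].
  rewrite -mulnn; move: h1 h2 h3 h4; clearbody e; lia.
have el : e%:R <= 2 * ln ((s * n * d * L)%:R : R).
  apply: exp2_le_ln; rewrite expnS; have h := trunc_logP (isT : (1 < 2)%N) dL0.
  apply: (@leq_trans (2 * (d * L))%N); first by rewrite leq_mul2l h.
  by rewrite -[X in (_ <= X)%N]mulnA leq_mul2r (leq_trans s2) ?orbT // leq_pmulr.
apply: (@le_trans _ _ ((194 * (d ^ 2 * L + s * d) * e)%:R : R)); first by rewrite ler_nat.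
rewrite natrM [(194 * _)%:R]natrM.
apply: (@le_trans _ _ (194%:R * (d ^ 2 * L + s * d)%:R * (2 * ln ((s * n * d * L)%:R : R)))).
  by rewrite ler_wpM2l // mulr_ge0 ?ler0n.
by rewrite le_eqVlt; apply/orP; left; apply/eqP; ring.
Qed.

End Asymptotics.

Theorem theorem1p1 (R : realType) :
  (forall k : coins,
     soft_Theta rows_one_server
       (randomized_complexity R k coordinator_model)
       (fun s d L => d ^ 2 * L + s * d)%N) /\
  soft_Theta rows_all_servers
    (deterministic_complexity R coordinator_model)
    (fun s d L => s * d ^ 2 * L)%N /\
  (forall k : coins,
     soft_Theta rows_one_server
       (randomized_complexity R k blackboard_model)
       (fun s d L => d ^ 2 * L + s)%N) /\
  soft_Theta rows_one_server
    (deterministic_complexity R blackboard_model)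
    (fun s d L => d ^ 2 * L + s)%N.
Proof.
have board_upper s n d L : (0 < d)%N -> (0 < L)%N ->
    exists2 c, deterministically_solvable R blackboard_model s n d L c &
      c%:R <= 14%:R * (d ^ 2 * L + s)%:R * logpow R 0 s n d L.
  move=> d0 L0; exists ((d + 1) * ((d + 1) * (L + 2)).+1 + s)%N.
    exact: deterministic_board_protocol.
  rewrite /logpow expr0 mulr1 -natrM ler_nat.
  have : ((d + 1) * ((d + 1) * (L + 2)).+1 <= (2 * d) * ((2 * d) * (3 * L)).+1)%N.
    by apply: leq_mul; rewrite ?ltnS; [lia|apply: leq_mul; lia].
  have : (d <= d * d * L)%N by rewrite -mulnA leq_pmulr // muln_gt0 d0.
  by rewrite -mulnn; lia.
have board_lower s n d L c : (2 <= s)%N -> (0 < d)%N -> (0 < L)%N ->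
    (rows_one_server s d <= n)%N ->
    randomly_solvable R public_coins blackboard_model s n d L c ->
    14%:R^-1 * (d ^ 2 * L + s)%:R / logpow R 0 s n d L <= c%:R.
  move=> s2 d0 L0 hn /(board_lower_bound s2 d0 L0 hn) h.
  by rewrite /logpow expr0 divr1 mulrC ler_pdivrMr ?ltr0n // mulrC -natrM ler_nat.
(* Lower bounds pass from public coins to either [k], upper bounds from private coins. Only the
   first of the four cases uses the logarithm to the power 1. *)
split; [move=> k|split; [|split; [move=> k|]]].
- split.
    apply: (@soft_O_of_protocols R (fun s n d L c => randomly_solvable R k _ s n d L c) _ 388%:R 1).
    move=> s n d L s2 n0 d0 L0; have [c H cle] := coordinator_upper_bound R s2 n0 d0 L0.
    by exists c; [apply: randomly_of_private|rewrite /logpow expr1].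
  apply: (@soft_Omega_of_costs R _ (fun s n d L c => randomly_solvable R k _ s n d L c) _ 324%:R^-1 1).
    by rewrite invr_gt0 ltr0n.
  move=> s n d L c s2 n0 d0 L0 hn /public_of_randomly H.
  have := coordinator_lower_bound s2 n0 d0 L0 hn H; rewrite /logpow expr1.
  have ln0 : 0 < ln ((s * n * d * L)%:R : R).
    apply: ln_gt0; rewrite ltr1n; have : (0 < n * d * L)%N by rewrite !muln_gt0 n0 d0.
    nia.
  rewrite ler_pdivrMr // [_^-1 * _]mulrC ler_pdivrMr ?ltr0n // => h.
  by apply: le_trans h _; rewrite le_eqVlt; apply/orP; left; apply/eqP; ring.
- split.
    apply: (@soft_O_of_protocols R (fun s n d L c => deterministically_solvable R _ s n d L c) _ 12%:R 0).
    move=> s n d L s2 n0 d0 L0; exists (s * ((d + 1) * ((d + 1) * (L + 2))))%N.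
      exact: deterministic_coordinator_protocol.
    rewrite /logpow expr0 mulr1 -natrM ler_nat.
    apply: (@leq_trans (s * ((2 * d) * ((2 * d) * (3 * L))))%N); last by rewrite -mulnn; lia.
    by rewrite leq_mul2l; apply/orP; right; do 2 (apply: leq_mul; first lia); lia.
  apply: (@soft_Omega_of_costs R _ (fun s n d L c => deterministically_solvable R _ s n d L c) _ 24%:R^-1 0).
    by rewrite invr_gt0 ltr0n.
  move=> s n d L c s2 n0 d0 L0; rewrite /rows_all_servers => hn H.
  rewrite /logpow expr0 divr1 mulrC ler_pdivrMr ?ltr0n // mulrC -natrM ler_nat.
  have [m [k [dE dmk]]] := halve d0.
  have : (s * (L * (k.+1 * m.+1)) <= 6 * c)%N.
    by rewrite dE in hn H; exact: (deterministic_coordinator_bound s2 hn H).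
  have : (s * L * d ^ 2 <= s * L * (4 * (k.+1 * m.+1)))%N by rewrite leq_mul2l dmk orbT.
  lia.
- split.
    apply: (@soft_O_of_protocols R (fun s n d L c => randomly_solvable R k _ s n d L c) _ 14%:R 0).
    move=> s n d L s2 n0 d0 L0; have [c H cle] := board_upper s n d L d0 L0.
    by exists c => //; apply/randomly_of_private/randomly_of_deterministically.
  apply: (@soft_Omega_of_costs R _ (fun s n d L c => randomly_solvable R k _ s n d L c) _ 14%:R^-1 0).
    by rewrite invr_gt0 ltr0n.
  by move=> s n d L c s2 n0 d0 L0 hn /public_of_randomly; apply: board_lower.
- split.
    apply: (@soft_O_of_protocols R (fun s n d L c => deterministically_solvable R _ s n d L c) _ 14%:R 0).
    by move=> s n d L s2 n0 d0 L0; apply: board_upper.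
  apply: (@soft_Omega_of_costs R _ (fun s n d L c => deterministically_solvable R _ s n d L c) _ 14%:R^-1 0).
    by rewrite invr_gt0 ltr0n.
  move=> s n d L c s2 n0 d0 L0 hn /randomly_of_deterministically /public_of_private.
  exact: board_lower.
Qed.
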